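(* Let $\lambda$ and $\mu$ be partitions. Then $$\Delta\left(\mathrm{TW}^{\lambda\,\varnothing}\cdot \mathrm{TW}^{\varnothing\,\mu}\right)=\mathrm{TW}^{\lambda\,\mu}\qquad\text{and}\qquad \mathbf{\Delta}\left(\mathbf{TW}^{\lambda\,\varnothing}\cdot \mathbf{TW}^{\varnothing\,\mu}\right)=\mathbf{TW}^{\lambda\,\mu}.$$
   Context: A partition is a finite weakly decreasing sequence of non-negative integers (extended by zeros when needed); $l(\lambda)$ is the number of nonzero parts and $\varnothing$ is the trivial partition. Let $\mathbf{\Lambda}(\overline X)$, $\mathbf{\Lambda}(\overline Y)$ be the algebras of symmetric functions over $\mathbb{Q}$ in the countable variable sets $\overline X=\{x_1,x_2,\dots\}$ and $\overline Y=\{y_1,y_2,\dots\}$. Let $\mathbf{p}_k,\mathbf{h}_k$ be the power sum and complete homogeneous symmetric functions in $\overline X$, and $\tilde{\mathbf{p}}_k,\tilde{\mathbf{h}}_k$ those in $\overline Y$, with $\mathbf{h}_0=\tilde{\mathbf{h}}_0=1$ and $\mathbf{h}_k=\tilde{\mathbf{h}}_k=0$ for $k<0$. Let $\mathbf{\Lambda}(\overline X,\overline Y)=\mathbf{\Lambda}(\overline X)\otimes_{\mathbb{Q}}\mathbf{\Lambda}(\overline Y)$, which is the polynomial algebra over $\mathbb{Q}$ in the $\mathbf{p}_k,\tilde{\mathbf{p}}_k$, $k\ge1$. For partitions $\lambda,\mu$ and any integer $d\ge1$ with $\lambda_{d+1}=\mu_{d+1}=0$ (the result does not depend on the choice of $d$),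 set $$\mathbf{TW}^{\lambda\,\mu}=\det\left(\left(\tilde{\mathbf{h}}_{i-j+\mu_{d-i+1}}\right)_{1\le i\le d,\ j\ge1}\cdot\left(\mathbf{h}_{j-i+\lambda_{d-j+1}}\right)_{i\ge1,\ 1\le j\le d}\right)\in\mathbf{\Lambda}(\overline X,\overline Y),$$ the determinant of the $d\times d$ product of a $d\times\infty$ and an $\infty\times d$ matrix ($i$ is the row index and $j$ the column index in each; each entry of the product is a finite sum). Let $p_1,p_2,\dots,\tilde p_1,\tilde p_2,\dots$ be independent commuting variables, $V=\mathbb{Q}[[p_1,p_2,\dots,\tilde p_1,\tilde p_2,\dots]]$, and let $F:\mathbf{\Lambda}(\overline X,\overline Y)\to V$ be the algebra homomorphism with $\mathbf{p}_k\mapsto p_k$, $\tilde{\mathbf{p}}_k\mapsto\tilde p_k$. Set $\mathrm{TW}^{\lambda\,\mu}=F(\mathbf{TW}^{\lambda\,\mu})$, a polynomial in the $p_k,\tilde p_k$. The operator $\Delta$ is $$\Delta=\exp\left(\sum_{k>0}k\,\partial_{p_k}\partial_{\tilde p_k}\right)=\prod_{k>0}\sum_{i\ge0}\frac{k^i}{i!}(\partial_{p_k}\partial_{\tilde p_k})^i,$$ where powers denote composition; on a polynomial in the $p_k,\tilde p_k$ only finitely many terms contribute. The operator $\mathbf{\Delta}$ on $\mathbf{\Lambda}(\overline X,\overline Y)$ is defined by the same formula with $\partial_{p_k},\partial_{\tilde p_k}$ replaced by $\partial_{\mathbf{p}_k},\partial_{\tilde{\mathbf{p}}_k}$. *)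

(* Defs.v *)
From HB Require Import structures.
From mathcomp Require Import all_boot all_order all_algebra.
From mathcomp Require Import finmap.
From mathcomp Require Import mathcomp_extra boolp classical_sets functions.
From mathcomp Require Import cardinality fsbigop.
From mathcomp Require Import monalg.

Set Implicit Arguments.
Unset Strict Implicit.
Unset Printing Implicit Defensive.

Import GRing.Theory Num.Theory.
Local Open Scope ring_scope.

(* monalg keeps these two notations local. *)
Local Notation "1" := (@mone _) : monom_scope.
Local Notation "x * y" := (mmul x y) : monom_scope.

(* Formal power series over Q in the variables I (possibly infinitely many). *)
Record fps (I : choiceType) := Fps { coef : {cmonom I} -> rat }.

Section FpsRing.
Context (I : choiceType).
Local Notation M := {cmonom I}.
Implicit Types (f g h : fps I) (m : M).

HB.instance Definition _ := [isNew for @coef I].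
HB.instance Definition _ := [Choice of fps I by <:].

Lemma fpsP f g : (forall m, coef f m = coef g m) -> f = g.
Proof. by move=> e; apply: val_inj; apply/funext. Qed.

Definition fps0 := Fps (fun _ : M => 0).
Definition fpsN f := Fps (fun m => - coef f m).
Definition fpsD f g := Fps (fun m => coef f m + coef g m).
Definition fpsZ (c : rat) f := Fps (fun m => c * coef f m).
Definition fps1 := Fps (fun m : M => (m == 1%M)%:R).

Definition factorizations m : set (M * M) := [set u | (u.1 * u.2)%M = m].

Definition fpsM f g :=
  Fps (fun m => \sum_(u \in factorizations m) coef f u.1 * coef g u.2).

Let addA : associative fpsD.
Proof. by move=> f g h; apply: fpsP => m /=; rewrite addrA. Qed.
Let addC : commutative fpsD.
Proof. by move=> f g; apply: fpsP => m /=; rewrite addrC. Qed.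
Let add0 : left_id fps0 fpsD.
Proof. by move=> f; apply: fpsP => m /=; rewrite add0r. Qed.
Let addN : left_inverse fps0 fpsN fpsD.
Proof. by move=> f; apply: fpsP => m /=; rewrite addNr. Qed.

HB.instance Definition _ := GRing.isZmodule.Build (fps I) addA addC add0 addN.

Lemma coefD f g m : coef (f + g) m = coef f m + coef g m. Proof. by []. Qed.
Lemma coef0 m : coef (0 : fps I) m = 0. Proof. by []. Qed.

Lemma finite_divisors m : finite_set [set u : M | exists v, (u * v)%M = m].
Proof.
pose S := finsupp m.
pose F (u : M) : {ffun S -> 'I_(mdeg m).+1} := [ffun i => inord (u (val i))].
have leu (u v : M) i : (u * v)%M = m -> (u i <= m i)%N.
  by move=> <-; rewrite cmM leq_addr.
have lem i : (m i <= mdeg m)%N.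
  have [iS|iS] := boolP (i \in finsupp m); last by move: iS; rewrite -cmE_eq0 => /eqP ->.
  by rewrite mdegE (big_fsetD1 i) //= leq_addr.
have inj : set_inj [set u : M | exists v, (u * v)%M = m] F.
  move=> u v /set_mem [u' hu] /set_mem [v' hv] /ffunP e; apply/eqP/cmP => i.
  have [iS|iS] := boolP (i \in S).
    have := e [` iS]%fset; rewrite !ffunE /= => /(congr1 val) /=.
    by rewrite !inordK // ltnS (leq_trans _ (lem i)) // ?(leu u u') ?(leu v v').
  have mi0 : m i = 0%N by apply/eqP; rewrite cmE_eq0.
  have := leu u u' i hu; have := leu v v' i hv.
  by rewrite mi0 !leqn0 => /eqP -> /eqP ->.
rewrite -(eq_finite_set (inj_card_eq inj)).
exact: finite_finset.
Qed.

Let divs m : {fset M} := fset_set [set u : M | exists v, (u * v)%M = m].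

Let mem_divs u v m : (u * v)%M = m -> u \in divs m.
Proof.
by move=> e; rewrite in_fset_set; [apply/mem_set; exists v | exact: finite_divisors].
Qed.

Let divs_sub u v m : (u * v)%M = m -> (divs u `<=` divs m)%fset.
Proof.
move=> e; apply/fsubsetP => a; rewrite in_fset_set; last exact: finite_divisors.
by move=> /set_mem [b ab]; apply: (@mem_divs _ (b * v)%M); rewrite mulmA ab.
Qed.

Lemma coefM_wide (S : {fset M}) f g m : (divs m `<=` S)%fset ->
  coef (fpsM f g) m =
    \sum_(u <- S) \sum_(v <- S | (u * v)%M == m) coef f u * coef g v.
Proof.
move=> /fsubsetP le.
pose r := [seq u <- [seq (a, b) | a <- S, b <- S] | (u.1 * u.2)%M == m].
rewrite /= (fsbigE r).
- rewrite big_mkcond big_filter big_mkcond big_allpairs; apply: eq_bigr => u _.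
  rewrite [RHS]big_mkcond; apply: eq_bigr => v _ /=; case: eqP => // e.
  by rewrite mem_set.
- by apply: filter_uniq; apply: allpairs_uniq => // -[? ?] [? ?].
- by move=> u /=; rewrite mem_filter => /andP[/eqP].
- move=> [u v] /= e; rewrite mem_filter /= e eqxx /= => /negP []; apply/allpairsP.
  exists (u, v); split => //; apply: le; first exact: mem_divs e.
  by apply: (@mem_divs _ u); rewrite mulmC.
Qed.

Let coefM_divs f g m := @coefM_wide (divs m) f g m (fsubset_refl _).

Let sum_pick (S : {fset M}) (w : M) (c : M -> bool) (x : rat) : w \in S ->
  \sum_(u <- S) (if (w == u) && c u then x else 0) = if c w then x else 0.
Proof.
move=> wS; rewrite (big_fsetD1 w) //= eqxx /= big_seq big1 ?addr0 // => u.
by rewrite in_fsetD1 eq_sym => /andP[/negbTE -> _].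
Qed.

Let mulA : associative fpsM.
Proof.
move=> f g h; apply: fpsP => m.
rewrite (coefM_divs f) (coefM_divs (fpsM f g)).
transitivity (\sum_(a <- divs m) \sum_(b <- divs m) \sum_(c <- divs m)
    if (a * b * c)%M == m then coef f a * coef g b * coef h c else 0).
  apply: eq_bigr => a _; rewrite big_mkcond.
  transitivity (\sum_(u <- divs m) \sum_(b <- divs m) \sum_(c <- divs m)
    if ((b * c)%M == u) && ((a * u)%M == m)
    then coef f a * coef g b * coef h c else 0).
    apply: eq_bigr => u _; case: eqP => e; last first.
      by rewrite big1 // => b _; rewrite big1 // => c _; rewrite andbF.
    rewrite (@coefM_wide (divs m)); last first.
      by apply: (@divs_sub _ a); rewrite mulmC.
    rewrite mulr_sumr; apply: eq_bigr => b _.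
    rewrite mulr_sumr big_mkcond; apply: eq_bigr => c _.
    by rewrite andbT; case: eqP => // _; rewrite mulrA.
  rewrite exchange_big; apply: eq_bigr => b _.
  rewrite exchange_big; apply: eq_bigr => c _ /=.
  have [e|ne] := eqVneq (a * b * c)%M m.
    rewrite (@sum_pick _ _ (fun u => (a * u)%M == m)); last first.
      by apply: (@mem_divs _ a); rewrite mulmC mulmA.
    by rewrite mulmA e eqxx.
  rewrite big1 // => u _; case: eqP => //= <-.
  by rewrite mulmA (negbTE ne).
transitivity (\sum_(u <- divs m) \sum_(c <- divs m) \sum_(a <- divs m)
    \sum_(b <- divs m) if ((a * b)%M == u) && ((u * c)%M == m)
    then coef f a * coef g b * coef h c else 0); last first.
  apply: eq_bigr => u _; rewrite [RHS]big_mkcond; apply: eq_bigr => c _.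
  case: eqP => e; last first.
    by rewrite big1 // => a _; rewrite big1 // => b _; rewrite andbF.
  rewrite (@coefM_wide (divs m) f g u); last exact: divs_sub e.
  rewrite mulr_suml; apply: eq_bigr => a _.
  rewrite mulr_suml [RHS]big_mkcond; apply: eq_bigr => b _.
  by rewrite andbT.
rewrite [RHS]exchange_big /=.
under [RHS]eq_bigr => c _ do rewrite exchange_big /=.
rewrite [RHS]exchange_big /=; apply: eq_bigr => a _.
rewrite [LHS]exchange_big /=; apply: eq_bigr => c _.
rewrite [RHS]exchange_big /=; apply: eq_bigr => b _.
have [e|ne] := eqVneq (a * b * c)%M m.
  rewrite (@sum_pick _ _ (fun u => (u * c)%M == m)); last exact: mem_divs e.
  by rewrite e eqxx.
by rewrite big1 // => u _; case: eqP => //= <-; rewrite (negbTE ne).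
Qed.

Let mulC : commutative fpsM.
Proof.
move=> f g; apply: fpsP => m; rewrite !coefM_divs.
under eq_bigr => u _ do rewrite big_mkcond.
rewrite exchange_big /=; apply: eq_bigr => u _; rewrite [RHS]big_mkcond.
by apply: eq_bigr => v _; rewrite mulmC mulrC.
Qed.

Let mul1 : left_id fps1 fpsM.
Proof.
move=> f; apply: fpsP => m; rewrite /= (fsbigE [:: (1%M, m)]) //=.
- by rewrite big_cons big_nil /= eqxx mul1r addr0 mem_set //= /factorizations /= mul1m.
- by move=> u /=; rewrite inE => /eqP -> /=; rewrite /factorizations /= mul1m.
- move=> [u v] /= e; rewrite inE /= => ne.
  case: eqP => [u1|_]; last by rewrite mul0r.
  by move: ne; rewrite /factorizations /= u1 mul1m in e *; rewrite e eqxx.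
Qed.

Let mulD : left_distributive fpsM fpsD.
Proof.
move=> f g h; apply: fpsP => m /=.
rewrite -[RHS]/(coef (fpsM f h) m + coef (fpsM g h) m).
rewrite -[LHS]/(coef (fpsM (fpsD f g) h) m).
rewrite !coefM_divs -big_split; apply: eq_bigr => u _.
by rewrite -big_split; apply: eq_bigr => v _ /=; rewrite mulrDl.
Qed.

Let one_neq0 : fps1 != 0 :> fps I.
Proof.
apply/eqP => /(congr1 (fun f => coef f 1%M)) /eqP.
by rewrite /= eqxx oner_eq0.
Qed.

HB.instance Definition _ :=
  GRing.Zmodule_isComNzRing.Build (fps I) mulA mulC mul1 mulD one_neq0.

Let scaleA a b f : fpsZ a (fpsZ b f) = fpsZ (a * b) f.
Proof. by apply: fpsP => m /=; rewrite mulrA. Qed.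
Let scale1 : left_id 1 fpsZ.
Proof. by move=> f; apply: fpsP => m /=; rewrite mul1r. Qed.
Let scaleDr : right_distributive fpsZ +%R.
Proof. by move=> a f g; apply: fpsP => m; exact: mulrDr. Qed.
Let scaleDl f : {morph fpsZ^~ f : a b / a + b}.
Proof. by move=> a b; apply: fpsP => m; exact: mulrDl. Qed.

HB.instance Definition _ :=
  GRing.Zmodule_isLmodule.Build rat (fps I) scaleA scale1 scaleDr scaleDl.

Let scaleAl (a : rat) f g : a *: (f * g) = (a *: f) * g.
Proof.
apply: fpsP => m.
rewrite -[RHS]/(coef (fpsM (fpsZ a f) g) m) -[LHS]/(a * coef (fpsM f g) m).
rewrite !coefM_divs mulr_sumr; apply: eq_bigr => u _.
by rewrite mulr_sumr; apply: eq_bigr => v _ /=; rewrite mulrA.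
Qed.

HB.instance Definition _ := GRing.Lmodule_isLalgebra.Build rat (fps I) scaleAl.
HB.instance Definition _ := GRing.Lalgebra_isComAlgebra.Build rat (fps I).

Lemma coefM f g m : coef (f * g) m =
  \sum_(u \in factorizations m) coef f u.1 * coef g u.2.
Proof. by []. Qed.
Lemma coef1 m : coef (1 : fps I) m = (m == 1%M)%:R. Proof. by []. Qed.
Lemma coefZ c f m : coef (c *: f) m = c * coef f m. Proof. by []. Qed.

Lemma finite_factorizations m : finite_set (factorizations m).
Proof.
apply: (@sub_finite_set _ _ [set` [seq (a, b) | a <- divs m, b <- divs m]]).
  move=> [u v] e /=; apply/allpairsP; exists (u, v); split => //.
    exact: mem_divs e.
  by apply: (@mem_divs _ u); rewrite mulmC.
exact: finite_seq.
Qed.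
End FpsRing.

(* [(false, i)] and [(true, i)] are the i-th variables (i >= 0) of the first
   alphabet X and of the second alphabet Y. *)
Definition var : Type := (bool * nat)%type.
HB.instance Definition _ := Countable.on var.

(* The algebra of symmetric functions in alphabet [b], inside Q[[X, Y]]: series
   of bounded degree, in the variables of [b] only, whose coefficients do not
   change when the variables are permuted (m' is m with x_i renamed x_(s i)). *)
Definition is_symfun (b : bool) (f : fps var) : Prop :=
  [/\ exists d, forall m, coef f m != 0 -> (mdeg m <= d)%N,
      forall m v, coef f m != 0 -> v \in finsupp m -> v.1 = b
    & forall (s : nat -> nat) (m m' : {cmonom var}), bijective s ->
        (forall c i, m' (c, s i) = m (c, i)) -> coef f m' = coef f m].

(* The tensor product of the two algebras, realized as the span in Q[[X, Y]] of
   the products f(X) g(Y). *)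
Definition is_symfun2 (f : fps var) : Prop :=
  exists2 r : seq (fps var * fps var),
    forall q, q \in r -> is_symfun false q.1 /\ is_symfun true q.2
  & f = \sum_(q <- r) q.1 * q.2.

Definition symfun2 : {pred fps var} := fun f => `[< is_symfun2 f >].

Section SymfunClosed.
Implicit Types (b : bool) (f g : fps var).

Let ren (s t : nat -> nat) (m : {cmonom var}) : {cmonom var} :=
  [cmonom m (v.1, t v.2) | v in [fset (v.1, s v.2) | v in finsupp m]%fset]%M.

Let renE s t m v : cancel t s -> ren s t m v = m (v.1, t v.2).
Proof.
move=> tK; rewrite cmE fsfun_fun; case: imfsetP => // nv.
apply/esym/eqP; rewrite cmE_eq0; apply/negP => iv; apply: nv.
by exists (v.1, t v.2) => //=; rewrite tK -surjective_pairing.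
Qed.

Lemma coefM_neq0 f g (m : {cmonom var}) : coef (f * g) m != 0 ->
  exists u v, [/\ (u * v)%M = m, coef f u != 0 & coef g v != 0].
Proof.
apply: contra_neqP => no; rewrite coefM fsbig1 // => -[u v] /= e.
apply/eqP; rewrite mulf_eq0; apply/negP => /negP; rewrite negb_or => /andP[fu gv].
by apply: no; exists u, v.
Qed.

Lemma symfun1 b : is_symfun b 1.
Proof.
have one (m : {cmonom var}) : coef 1 m != 0 -> m = 1%M.
  by rewrite coef1 pnatr_eq0 eqb0 negbK => /eqP.
split.
- by exists 0%N => m /one ->; rewrite mdeg1.
- by move=> m v /one ->; rewrite mdom1.
- move=> s m m' [t tK sK] e; rewrite !coef1; congr (_%:R : rat).
  congr nat_of_bool; apply/cmP/cmP => h [c i].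
    by rewrite -e h !cm1.
  by rewrite -[i]sK e h !cm1.
Qed.

Lemma symfunM b f g : is_symfun b f -> is_symfun b g -> is_symfun b (f * g).
Proof.
move=> [[d fd] fb fs] [[e ge] gb gs]; split.
- exists (d + e)%N => m /coefM_neq0 [u [v [<- fu gv]]].
  by rewrite mdegM leq_add ?fd ?ge.
- move=> m w /coefM_neq0 [u [v [<- fu gv]]].
  by rewrite mdomD inE => /orP[/(fb _ _ fu) | /(gb _ _ gv)].
- move=> s m m' [t tK sK] E; rewrite !coefM.
  pose h (u : {cmonom var} * {cmonom var}) := (ren s t u.1, ren s t u.2).
  have hE u : forall c i, ren s t u (c, s i) = u (c, i).
    by move=> c i; rewrite renE //= tK.
  have bs : bijective s by exists t.
  rewrite (@reindex_fsbig _ _ _ _ _ h (factorizations m)).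
    by apply: eq_fsbigr => u _; rewrite /= (fs s u.1) // (gs s u.2).
  split.
  + move=> [u v] /= uv; apply/eqP/cmP => -[c i].
    by rewrite cmM !renE //= -cmM uv -E sK.
  + move=> [u v] [u' v'] _ _ [/eqP/cmP eu /eqP/cmP ev].
    congr pair; apply/eqP/cmP => -[c i].
      by have := eu (c, s i); rewrite !hE.
    by have := ev (c, s i); rewrite !hE.
  + move=> [u v] /= uv; exists (ren t s u, ren t s v).
      by apply/eqP/cmP => -[c i]; rewrite cmM !renE //= -cmM uv E.
    by congr pair; apply/eqP/cmP => -[c i]; rewrite !renE //= sK.
Qed.

Lemma symfunZ b (a : rat) f : is_symfun b f -> is_symfun b (a *: f).
Proof.
move=> [[d fd] fb fs]; have nz m : coef (a *: f) m != 0 -> coef f m != 0.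
  by rewrite coefZ mulf_eq0 negb_or => /andP[].
split.
- by exists d => m /nz /fd.
- by move=> m v /nz /fb; exact.
- by move=> s m m' bs /(fs s m m' bs) e; rewrite !coefZ e.
Qed.

Lemma symfun2_subalg_closed : subalg_closed symfun2.
Proof.
split.
- apply/asboolP; exists [:: (1, 1)]; last by rewrite big_seq1 mulr1.
  by move=> q; rewrite inE => /eqP -> /=; split; exact: symfun1.
- move=> a f g /asboolP [r hr ->] /asboolP [r' hr' ->]; apply/asboolP.
  exists ([seq (a *: q.1, q.2) | q <- r] ++ r').
    move=> q; rewrite mem_cat => /orP[/mapP[q' /hr [h1 h2] ->]|/hr' //].
    by split => //; exact: symfunZ.
  rewrite big_cat big_map scaler_sumr; congr (_ + _).
  by apply: eq_bigr => q _; rewrite scalerAl.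
- move=> f g /asboolP [r hr ->] /asboolP [r' hr' ->]; apply/asboolP.
  exists [seq (p.1 * q.1, p.2 * q.2) | p <- r, q <- r'].
    move=> q /allpairsP [[u v] /= [/hr [? ?] /hr' [? ?] ->]] /=.
    by split; exact: symfunM.
  rewrite big_allpairs_dep mulr_suml; apply: eq_bigr => p _.
  by rewrite mulr_sumr; apply: eq_bigr => q _; rewrite /= mulrACA.
Qed.

HB.instance Definition _ :=
  GRing.isSubalgClosed.Build rat (fps var) symfun2
    (GRing.subalg_closed_semi symfun2_subalg_closed).
End SymfunClosed.

Record Lambda := MkLambda { series : fps var; _ : series \in symfun2 }.

HB.instance Definition _ := [isSub for series].
HB.instance Definition _ := [Choice of Lambda by <:].
HB.instance Definition _ := [SubChoice_isSubComNzRing of Lambda by <:].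
HB.instance Definition _ := [SubZmodule_isSubLmodule of Lambda by <:].
HB.instance Definition _ := [SubNzRing_SubLmodule_isSubLalgebra of Lambda by <:].
HB.instance Definition _ := [SubLalgebra_isSubAlgebra of Lambda by <:].

Section Generators.
Implicit Types (b : bool) (k n i : nat) (m : {cmonom var}).

(* Used for k > 0 only. *)
Definition psum_series b k : fps var :=
  Fps (fun m => `[< exists i, m = expcmn (ucm (b, i)) k >]%:R).

Definition hsym_series b n : fps var :=
  Fps (fun m => ((mdeg m == n) && all (fun v => v.1 == b) (finsupp m))%:R).

Lemma expcmnE m k v : expcmn m k v = (k * m v)%N.
Proof.
rewrite /expcmn; case: k => [|k]; first by rewrite onecmE.
rewrite iteropS; elim: k => [|k IH] /=; first by rewrite mul1n.
by rewrite mulcmE IH mulSn.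
Qed.

Lemma symfun_psum b k : is_symfun b (psum_series b k).
Proof.
have nz m : coef (psum_series b k) m != 0 -> exists i, m = expcmn (ucm (b, i)) k.
  by rewrite /= pnatr_eq0 eqb0 negbK => /asboolP.
split.
- exists k => m /nz [i ->]; rewrite (@mdegEw _ _ [fset (b, i)]%fset).
    by rewrite big_seq_fset1 expcmnE ucmE eqxx muln1.
  apply/fsubsetP => v; rewrite -cmE_neq0 expcmnE ucmE inE.
  by case: ((b, i) =P v) => [->|_]; rewrite ?eqxx ?muln0.
- move=> m v /nz [i ->]; rewrite -cmE_neq0 expcmnE ucmE.
  by case: ((b, i) =P v) => [<-//|_]; rewrite muln0.
- move=> s m m' [t tK sK] E; congr (nat_of_bool _)%:R; apply: asbool_equiv_eq.
  split=> -[i h].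
    exists (t i); apply/eqP/cmP => -[c j].
    rewrite -E h !expcmnE !ucmE; congr (_ * nat_of_bool _)%N.
    by apply/eqP/eqP => -[-> e]; congr pair; rewrite ?e ?tK // -e sK.
  exists (s i); apply/eqP/cmP => -[c j].
  rewrite -[j]sK E h !expcmnE !ucmE; congr (_ * nat_of_bool _)%N.
  by apply/eqP/eqP => -[-> e]; congr pair; rewrite ?e // -(tK i) e sK.
Qed.

Lemma symfun_hsym b n : is_symfun b (hsym_series b n).
Proof.
have nz m : coef (hsym_series b n) m != 0 ->
    mdeg m = n /\ forall v, v \in finsupp m -> v.1 = b.
  rewrite /= pnatr_eq0 eqb0 negbK => /andP[/eqP -> /allP h].
  by split => // v /h /eqP.
split.
- by exists n => m /nz [->].
- by move=> m v /nz [_ h] /h.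
- move=> s m m' bs E; have [t sK tK] := bs.
  have supp : finsupp m' = [fset (v.1, s v.2) | v in finsupp m]%fset.
    apply/fsetP => -[c i]; rewrite -cmE_neq0; apply/idP/imfsetP => /=.
      rewrite -{1}[i]tK E cmE_neq0 => h; exists (c, t i) => //=.
      by rewrite tK.
    by move=> [[d j] /= h [-> ->]]; rewrite E cmE_neq0.
  have inj : injective (fun v : var => (v.1, s v.2)).
    by move=> [c i] [d j] [-> /(bij_inj bs) ->].
  congr (nat_of_bool (_ && _))%:R.
    rewrite !mdegE supp big_imfset /=; last by move=> u v _ _; apply: inj.
    by congr (_ == _); apply: eq_bigr => -[c i] _; rewrite E.
  apply/allP/allP => h v.
    by move=> vm; apply: (h (v.1, s v.2)); rewrite supp; apply/imfsetP; exists v.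
  by rewrite supp => /imfsetP [u /= /h hu ->].
Qed.

Lemma symfun_symfun2 b f : is_symfun b f -> f \in symfun2.
Proof.
move=> hf; apply/asboolP.
exists [:: if b then (1, f) else (f, 1)].
  by case: b hf => hf q; rewrite inE => /eqP ->; split=> //; exact: symfun1.
by rewrite big_seq1; case: b {hf}; rewrite ?mul1r ?mulr1.
Qed.

Definition psum b k : Lambda :=
  MkLambda (symfun_symfun2 (symfun_psum b k)).

Definition hsym b (z : int) : Lambda :=
  if z is Posz n then MkLambda (symfun_symfun2 (symfun_hsym b n)) else 0.

Lemma hsym0 b : hsym b 0 = 1.
Proof.
apply: val_inj; apply: fpsP => m; rewrite /= mdeg_eq0.
by case: (m =P 1%M) => [->|//]; rewrite mdom1.
Qed.
End Generators.

(* Q[p_1, p_2, ..., p~_1, p~_2, ...]; here and in [V] the variable [(false, j)]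
   stands for p_(j+1) and [(true, j)] for p~_(j+1). *)
Definition ppoly : Type := {malg rat[{cmonom var}]}.
HB.instance Definition _ := GRing.ComAlgebra.on ppoly.

Definition psum_mon (w : {cmonom var}) : Lambda :=
  \prod_(v <- finsupp w) psum v.1 v.2.+1 ^+ w v.

Definition psum_eval (P : ppoly) : Lambda :=
  \sum_(w <- msupp P) P@_w *: psum_mon w.

(* The polynomial expressing [f] in the power sums; it exists and is unique by
   [psum_coordK] and [psum_evalK]. *)
Definition psum_coord (f : Lambda) : ppoly :=
  xget 0 [set P : ppoly | psum_eval P = f].

Section PowerSumBasis.
Implicit Types (b : bool) (m w : {cmonom var}) (v : var).

(* [ty m] records the multiset of the exponents of m, alphabet by alphabet: it
   is the index of the power sum product p_lambda(X) p_mu(Y) whose leading term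
   is m. *)
Let ty m : {cmonom var} :=
  \big[mmul/1%M]_(v <- finsupp m) ucm (v.1, (m v).-1).

Local Notation pw v k := (expcmn (ucm v) k).
Let rm v m := divcm m (pw v (m v)).
Let ns m := size (finsupp m).

Let pwE v k u : pw v k u = (if v == u then k else 0)%N.
Proof. by rewrite expcmnE ucmE; case: eqP; rewrite ?muln1 ?muln0. Qed.

Let rmE v m u : rm v m u = if v == u then 0%N else m u.
Proof. by rewrite divcmE pwE; case: eqP => [->|]; rewrite ?subnn ?subn0. Qed.

Let supp_rm v m : finsupp (rm v m) = (finsupp m `\ v)%fset.
Proof.
apply/fsetP => u; rewrite -cmE_neq0 rmE in_fsetD1 -cmE_neq0 [u == v]eq_sym.
by case: (v =P u).
Qed.

Let ty_rm v m : v \in finsupp m -> ty m = (ucm (v.1, (m v).-1) * ty (rm v m))%M.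
Proof.
move=> vm; rewrite /ty (big_fsetD1 v) //= supp_rm; congr (_ * _)%M.
rewrite !big_seq; apply: eq_bigr => u; rewrite in_fsetD1 => /andP[uv _].
by rewrite rmE eq_sym (negbTE uv).
Qed.

Let ns_rm v m : v \in finsupp m -> ns m = (ns (rm v m)).+1.
Proof. by move=> vm; rewrite /ns supp_rm (cardfsD1 v (finsupp m)) vm. Qed.

Let ty_deg m : mdeg (ty m) = ns m.
Proof.
rewrite /ty mdeg_prod (eq_bigr (fun=> 1%N)) => [|v _]; last exact: mdegU.
by rewrite sum1_size.
Qed.

Let in_ty m b j : (b, j) \in finsupp (ty m) ->
  exists2 v, v \in finsupp m & v.1 = b /\ m v = j.+1.
Proof.
rewrite /ty => h; have : has (fun v => (v.1, (m v).-1) == (b, j)) (finsupp m).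
  apply: contraTT h => /hasPn no.
  rewrite -cmE_eq0; apply/eqP; rewrite big_seq.
  elim/big_ind: _ => [|x y hx hy|v /no ne]; first by rewrite cm1.
    by rewrite cmM hx hy.
  by rewrite cmU (negbTE ne).
case/hasP => v vm /eqP [vb vj]; exists v => //; split=> //.
by rewrite -vj prednK // lt0n cmE_neq0.
Qed.

Let mulm_inj u w w' : (u * w)%M = (u * w')%M -> w = w' :> {cmonom var}.
Proof.
move=> e; apply/eqP/cmP => v; apply/eqP; rewrite -(eqn_add2l (u v)) -!cmM.
by rewrite e.
Qed.

(* Two monomials of the same type differ by a permutation of the variables. *)
Let ty_bij b m m' : ty m = ty m' -> (forall v, v \in finsupp m -> v.1 = b) ->
  exists2 s : nat -> nat, bijective s & forall c i, m' (c, s i) = m (c, i).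
Proof.
move: {2}(ns m) (erefl (ns m)) => n; elim: n m m' => [|n IH] m m' mn tym mb.
  have em (m1 : {cmonom var}) : ns m1 = 0%N -> forall v, m1 v = 0%N.
    move=> h v; apply/eqP; rewrite cmE_eq0; apply/negP => vm.
    by have := ns_rm vm; rewrite h.
  exists id; first by exists id.
  by move=> c i; rewrite !em // -ty_deg -tym ty_deg.
have [v vm] : exists v, v \in finsupp m.
  by apply/fset0Pn; rewrite -cardfs_gt0 -[#|`_|]/(ns m) mn.
case: v vm (mb _ vm) => [b' i] vm /= e; subst b'.
have mi : m (b, i) = (m (b, i)).-1.+1 by rewrite prednK // lt0n cmE_neq0.
have [[b' i'] /= vm' [e mi']] : exists2 v, v \in finsupp m' &
    v.1 = b /\ m' v = (m (b, i)).-1.+1.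
  by apply: in_ty; rewrite -tym (ty_rm vm) mdomD mdomU !inE eqxx.
subst b'; rewrite -mi in mi'.
have [|||s1 bs1 E1] := IH (rm (b, i) m) (rm (b, i') m').
- by move: mn; rewrite (ns_rm vm) => -[].
- have e1 := ty_rm vm; have e2 := ty_rm vm'; rewrite /= mi' in e1 e2.
  by apply: mulm_inj (etrans (esym e1) (etrans tym e2)).
- by move=> v; rewrite supp_rm in_fsetD1 => /andP[_ /mb].
have m'b v : v \in finsupp m' -> v.1 = b.
  case: v => c x xm'; have : (c, (m' (c, x)).-1) \in finsupp (ty m).
    by rewrite tym (ty_rm xm') mdomD mdomU !inE eqxx.
  by case/in_ty => v /mb <- [].
have m0 c x : c != b -> m (c, x) = 0%N.
  by move=> cb; apply/eqP; rewrite cmE_eq0; apply: contra cb => /mb /= ->.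
have m'0 c x : c != b -> m' (c, x) = 0%N.
  by move=> cb; apply/eqP; rewrite cmE_eq0; apply: contra cb => /m'b /= ->.
pose s x := if x == i then i' else if s1 x == i' then s1 i else s1 x.
have [t1 s1K t1K] := bs1.
exists s.
  pose t y := if y == i' then i else if y == s1 i then t1 i' else t1 y.
  exists t => x; rewrite /s /t.
    case: (x =P i) => [->|xi]; first by rewrite eqxx.
    case: (s1 x =P i') => [e|ne].
      case: (s1 i =P i') => [e'|_]; last by rewrite eqxx -e s1K.
      by case: xi; apply: (bij_inj bs1); rewrite e e'.
    case: (s1 x =P s1 i) => [/(bij_inj bs1) //|_].
    by rewrite s1K; case: (s1 x =P i').
  case: (x =P i') => [->|xi]; first by rewrite eqxx.
  case: (x =P s1 i) => [->|ne].
    case: (t1 i' =P i) => [<-|]; first by rewrite t1K.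
    by rewrite t1K eqxx.
  rewrite t1K; case: (t1 x =P i) => [e|_]; first by case: ne; rewrite -e t1K.
  by case: (x =P i').
move=> c x; case: (c =P b) => [->|/eqP cb]; last by rewrite m0 // m'0.
have E x' : (if (b, i') == (b, s1 x') then 0 else m' (b, s1 x'))%N =
            (if (b, i) == (b, x') then 0 else m (b, x'))%N.
  by rewrite -!rmE E1.
have pE (y z : nat) : ((b, y) == (b, z)) = (y == z) by rewrite xpair_eqE eqxx.
rewrite /s; case: (x =P i) => [->|xi]; first by rewrite mi'.
case: (s1 x =P i') => [e|ne]; last first.
  have := E x; rewrite !pE eq_sym (introF eqP ne) eq_sym.
  by rewrite (introF eqP xi).
have := E x; rewrite !pE e eqxx eq_sym (introF eqP xi) => <-.
have := E i; rewrite !pE eqxx; case: (i' =P s1 i) => // e'.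
by case: xi; apply: (bij_inj bs1); rewrite e e'.
Qed.

Let ex_ty w : exists m, ty m = w.
Proof.
move: {2}(mdeg w) (erefl (mdeg w)) => n; elim: n w => [|n IH] w wn.
  exists 1%M; rewrite /ty mdom1 big_seq_fset0.
  by apply/esym/eqP; rewrite -mdeg_eq0 wn.
have [u uw] : exists u, u \in finsupp w.
  apply/fset0Pn; apply/negP => /eqP w0.
  by move: wn; rewrite mdegE w0 big_seq_fset0.
have ew : w = (ucm u * divcm w (ucm u))%M.
  apply/eqP/cmP => x; rewrite cmM divcmE cmU.
  case: (u =P x) => [<-|_]; last by rewrite subn0.
  by rewrite subnKC // lt0n cmE_neq0.
have [|m tm] := IH (divcm w (ucm u)).
  by move: wn; rewrite {1}ew mdegM mdegU add1n => -[].
pose N := (\max_(v <- finsupp m) v.2).+1; pose v : var := (u.1, N).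
have mv : m v = 0%N.
  apply/eqP; rewrite cmE_eq0; apply/negP => vm.
  have : (v.2 <= \max_(v <- finsupp m) v.2)%N by apply: leq_bigmax_seq.
  by rewrite /= ltnn.
have mE : (m * pw v u.2.+1)%M v = u.2.+1 by rewrite cmM pwE eqxx mv.
exists (m * pw v u.2.+1)%M; rewrite (@ty_rm v); last by rewrite -cmE_neq0 mE.
have uE : (v.1, u.2.+1.-1) = u by rewrite [RHS]surjective_pairing.
rewrite mE uE [RHS]ew; congr (_ * _)%M.
rewrite -tm; congr ty; apply/eqP/cmP => x; rewrite rmE cmM pwE.
by case: (v =P x) => [<-|_]; rewrite ?mv ?addn0.
Qed.

Let coef_psumM b k (g : fps var) m : (0 < k)%N ->
  coef (psum_series b k * g) m =
  \sum_(v <- finsupp m | (v.1 == b) && (k <= m v)%N) coef g (divcm m (pw v k)).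
Proof.
move=> k0; rewrite coefM.
pose r := [seq (pw v k, divcm m (pw v k)) |
           v <- finsupp m & (v.1 == b) && (k <= m v)%N].
have fac v : (k <= m v)%N -> (pw v k * divcm m (pw v k))%M = m.
  move=> le; apply/eqP/cmP => x; rewrite cmM divcmE pwE.
  by case: (v =P x) => [<-|_]; rewrite ?subnKC // subn0.
rewrite (fsbigE r).
- rewrite big_map big_filter_cond; apply: eq_big => [v|v /andP[/andP[/eqP vb le] _]].
    by rewrite andb_idr // => /andP[_ le]; apply/mem_set; exact: fac.
  rewrite /= (_ : `[< _ >] = true) ?mul1r //.
  by apply/asboolP; exists v.2; rewrite -vb -surjective_pairing.
- rewrite map_inj_in_uniq ?filter_uniq ?fset_uniq // => u v _ _ [/eqP/cmP /(_ u) + _].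
  by rewrite !pwE eqxx; case: (v =P u) => // _ e; move: k0; rewrite e.
- move=> u /= /mapP [v]; rewrite mem_filter => /andP[/andP[_ le] _] -> /=.
  exact: fac.
- move=> [u1 u2] /= e ne; case: asboolP; last by rewrite mul0r.
  move=> [i u1E]; case/negP: ne; apply/mapP; exists (b, i); last first.
    congr pair => //; apply: (@mulm_inj u1); rewrite e u1E.
    by rewrite fac // -e cmM u1E pwE eqxx leq_addr.
  have le : (k <= m (b, i))%N by rewrite -e cmM u1E pwE eqxx leq_addr.
  by rewrite mem_filter /= eqxx le -cmE_neq0 -lt0n (leq_trans k0 le).
Qed.

Let psum_monM w w' : psum_mon (w * w')%M = psum_mon w * psum_mon w'.
Proof.
have wide (D : {fset var}) (x : {cmonom var}) : (finsupp x `<=` D)%fset ->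
    psum_mon x = \prod_(v <- D) psum v.1 v.2.+1 ^+ x v.
  move=> le; rewrite /psum_mon; apply: big_fset_incl => // v _.
  by rewrite -cmE_eq0 => /eqP ->.
pose D := (finsupp w `|` finsupp w')%fset.
rewrite (wide D) ?mdomD // (wide D w) ?fsubsetUl // (wide D w') ?fsubsetUr //.
by rewrite -big_split; apply: eq_bigr => v _; rewrite cmM exprD.
Qed.

Let psum_mon1 : psum_mon 1%M = 1.
Proof. by rewrite /psum_mon mdom1 big_seq_fset0. Qed.

Let psum_monU v : psum_mon (ucm v) = psum v.1 v.2.+1.
Proof. by rewrite /psum_mon mdomU big_seq_fset1 cmUU. Qed.

Let E w := series (psum_mon w).

Let E_spec n w m : mdeg w = n ->
  [/\ 0 <= coef (E w) m, (n < ns m)%N -> coef (E w) m = 0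
    & ns m = n -> (coef (E w) m != 0) = (ty m == w)].
Proof.
elim: n w m => [|n IH] w m wn.
  have -> : w = 1%M by apply/eqP; rewrite -mdeg_eq0 wn.
  rewrite /E psum_mon1 (_ : series 1 = 1) // coef1; split => //.
  - by case: eqP => // ->; rewrite /ns mdom1.
  - move=> m0; rewrite pnatr_eq0 eqb0 negbK.
    rewrite -[in RHS]mdeg_eq0 ty_deg m0 eqxx; apply/cmP => v; rewrite cm1.
    apply/eqP; rewrite cmE_eq0; apply/negP => vm.
    by have := ns_rm vm; rewrite m0.
have [u uw] : exists u, u \in finsupp w.
  apply/fset0Pn; apply/negP => /eqP w0.
  by move: wn; rewrite mdegE w0 big_seq_fset0.
have ew : w = (ucm u * divcm w (ucm u))%M.
  apply/eqP/cmP => x; rewrite cmM divcmE cmU.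
  case: (u =P x) => [<-|_]; last by rewrite subn0.
  by rewrite subnKC // lt0n cmE_neq0.
have w'n : mdeg (divcm w (ucm u)) = n.
  by move: wn; rewrite {1}ew mdegM mdegU add1n => -[].
move: (divcm w (ucm u)) ew w'n => w' -> {w wn uw} w'n; set k := u.2.+1.
have -> : E (ucm u * w')%M = psum_series u.1 k * E w'.
  by rewrite /E psum_monM psum_monU.
rewrite coef_psumM //.
have ge0 x : 0 <= coef (E w') x by case: (IH w' x w'n).
have nsge v : (k <= m v)%N -> (ns m <= (ns (divcm m (pw v k))).+1)%N.
  move=> le; rewrite (@ns_rm v); last by rewrite -cmE_neq0 -lt0n (leq_trans _ le).
  rewrite ltnS; apply: fsubset_leq_card; apply/fsubsetP => x.
  rewrite -!cmE_neq0 rmE divcmE pwE; case: (v =P x) => // _.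
  by rewrite subn0.
have nseq v : (k < m v)%N -> ns (divcm m (pw v k)) = ns m.
  move=> lt; congr (#|` _|); apply/fsetP => x; rewrite -!cmE_neq0 divcmE pwE.
  case: (v =P x) => [<-|_]; last by rewrite subn0.
  by rewrite -!lt0n subn_gt0 lt (leq_trans _ lt).
split.
- by apply: sumr_ge0 => v _; exact: ge0.
- move=> lt; rewrite big1 // => v /andP[_ le].
  have [_ + _] := IH w' (divcm m (pw v k)) w'n; apply.
  by rewrite -ltnS (leq_trans lt) // nsge.
- move=> mn.
  have term v : v \in finsupp m -> v.1 == u.1 -> (k <= m v)%N ->
      (coef (E w') (divcm m (pw v k)) != 0) =
      (m v == k) && (ty m == (ucm u * w')%M).
    move=> vm /eqP vu le; have [_ h0 hn] := IH w' (divcm m (pw v k)) w'n.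
    have [e|ne] := eqVneq (m v) k; last first.
      rewrite h0 ?eqxx // nseq ?mn //.
      by rewrite ltn_neqAle le eq_sym ne.
    have eR : rm v m = divcm m (pw v k) by rewrite /rm e.
    rewrite hn; last by move: mn; rewrite (ns_rm vm) eR => -[].
    rewrite (ty_rm vm) eR e vu -surjective_pairing.
    by apply/eqP/eqP => [->|/mulm_inj].
  rewrite psumr_neq0; last by move=> v _; exact: ge0.
  apply/hasP/idP => [[v vm /andP[/andP[vu le]]]|/eqP tm].
    by rewrite lt0r => /andP[+ _]; rewrite term // => /andP[].
  have [|v vm [vu mv]] := @in_ty m u.1 u.2.
    by rewrite -surjective_pairing tm mdomD mdomU !inE eqxx.
  exists v => //; rewrite vu eqxx mv leqnn /= lt0r ge0 andbT.
  by rewrite term ?vu ?mv ?tm ?eqxx.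
Qed.

Let psum_evalE P : psum_eval P = mmap (GRing.in_alg Lambda) psum_mon P.
Proof. by rewrite /psum_eval mmapE; apply: eq_bigr => w _; rewrite mulr_algl. Qed.

Let psum_mon_mmorph : mmorphism psum_mon.
Proof. by split; [exact: psum_monM | exact: psum_mon1]. Qed.
HB.instance Definition _ := isMultiplicative.Build _ _ psum_mon psum_mon_mmorph.

Lemma psum_evalB : {morph psum_eval : P Q / P - Q}.
Proof. by move=> P Q; rewrite !psum_evalE raddfB. Qed.

Lemma psum_evalD : {morph psum_eval : P Q / P + Q}.
Proof. by move=> P Q; rewrite !psum_evalE raddfD. Qed.

Lemma psum_evalM : {morph psum_eval : P Q / P * Q}.
Proof.
by move=> P Q; rewrite !psum_evalE rmorphM.
Qed.

Lemma psum_eval1 : psum_eval 1 = 1.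
Proof.
by rewrite psum_evalE rmorph1.
Qed.

Lemma psum_evalZ (c : rat) P : psum_eval (c *: P) = c *: psum_eval P.
Proof. by rewrite !psum_evalE mmapZ mulr_algl. Qed.

Lemma psum_evalU c w : psum_eval << c *g w >> = c *: psum_mon w.
Proof. by rewrite psum_evalE mmapU mulr_algl. Qed.

Lemma seriesP (f g : Lambda) : series f = series g -> f = g.
Proof. exact: val_inj. Qed.

Let coef_sum (J : Type) (r : seq J) (G : J -> fps var) m :
  coef (\sum_(j <- r) G j) m = \sum_(j <- r) coef (G j) m.
Proof. exact: (big_morph (fun f => coef f m)). Qed.

Let coef_eval (D : {fset {cmonom var}}) P m : (msupp P `<=` D)%fset ->
  coef (series (psum_eval P)) m = \sum_(w <- D) P@_w * coef (E w) m.
Proof.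
move=> le; have -> : series (psum_eval P) = \sum_(w <- msupp P) P@_w *: E w.
  exact: (raddf_sum (\val : Lambda -> fps var)).
rewrite coef_sum; apply: big_fset_incl => // w _ wP.
by rewrite coefZ (mcoeff_outdom wP) mul0r.
Qed.

Let le_mdeg m v : (m v <= mdeg m)%N.
Proof.
have [vm|] := boolP (v \in finsupp m); last by rewrite -cmE_eq0 => /eqP ->.
by rewrite mdegE (big_fsetD1 v) //= leq_addr.
Qed.

Let ns_mdeg m : (ns m <= mdeg m)%N.
Proof.
rewrite /ns mdegE -sum1_size !big_seq; apply: leq_sum => v.
by rewrite -cmE_neq0 lt0n.
Qed.

(* The power sums are algebraically independent ... *)
Lemma psum_eval_inj : injective psum_eval.
Proof.
suff inj0 P : psum_eval P = 0 -> P = 0.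
  move=> P Q e; apply/eqP; rewrite -subr_eq0; apply/eqP; apply: inj0.
  by rewrite psum_evalB e subrr.
move=> P0; apply/eqP; rewrite -msupp_eq0; apply/negP => /negP /fset0Pn [w0 w0P].
have [w wP wmax] : exists2 w, w \in msupp P &
    forall w', w' \in msupp P -> (mdeg w' <= mdeg w)%N.
  pose x0 := [` w0P]%fset.
  case: (@arg_maxnP _ x0 xpredT (fun x => mdeg (val x))) => // x _ h.
  exists (val x); first exact: valP.
  by move=> w' w'P; apply: (h [` w'P]%fset).
have [m tm] := ex_ty w.
have nsm : ns m = mdeg w by rewrite -ty_deg tm.
have /eqP := coef_eval m (fsubset_refl (msupp P)).
rewrite P0 (big_fsetD1 w) //= big_seq big1 => [|w'].
  rewrite addr0 eq_sym mulf_eq0 mcoeff_eq0 wP /=.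
  have [_ _ /(_ nsm)] := E_spec m (erefl (mdeg w)).
  by rewrite tm eqxx => /negP.
rewrite in_fsetD1 => /andP[ne w'P].
have [_ h0 hn] := E_spec m (erefl (mdeg w')).
have := wmax _ w'P; rewrite leq_eqVlt => /orP[/eqP e|lt].
  have := hn (etrans nsm (esym e)); rewrite tm [w == _]eq_sym (negbTE ne).
  by move/negbFE/eqP => ->; rewrite mulr0.
by rewrite h0 ?mulr0 // nsm.
Qed.

Let symfunD b f g : is_symfun b f -> is_symfun b g -> is_symfun b (f + g).
Proof.
move=> [[d fd] fb fs] [[e ge] gb gs].
have nz m : coef (f + g) m != 0 -> coef f m != 0 \/ coef g m != 0.
  rewrite coefD => h; have [f0|] := eqVneq (coef f m) 0; last by left.
  by right; move: h; rewrite f0 add0r.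
split.
- by exists (maxn d e) => m /nz [/fd|/ge] h; rewrite leq_max h ?orbT.
- by move=> m v /nz [/fb|/gb]; apply.
- by move=> s m m' bs h; rewrite !coefD (fs s m m') // (gs s m m').
Qed.

Let symfun_E b w : (forall v, v \in finsupp w -> v.1 = b) -> is_symfun b (E w).
Proof.
move=> wb; have -> : E w =
    \prod_(v <- finsupp w) psum_series v.1 v.2.+1 ^+ w v.
  rewrite [LHS](rmorph_prod (\val : Lambda -> fps var)).
  by apply: eq_bigr => v _; rewrite (rmorphXn (\val : Lambda -> fps var)).
rewrite big_seq; elim/big_ind: _ => [|f g|v /wb ->].
- exact: symfun1.
- exact: symfunM.
- elim: (w v) => [|n IH]; first exact: symfun1.
  by rewrite exprS; apply: symfunM => //; exact: symfun_psum.
Qed.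

Let symfun_ty b f m m' : is_symfun b f -> ty m = ty m' ->
  (forall v, v \in finsupp m -> v.1 = b) -> coef f m' = coef f m.
Proof.
move=> [_ _ fs] tm mb; have [s bs e] := ty_bij tm mb.
exact: fs bs e.
Qed.

(* ... and generate. *)
Let symfun_eval b f : is_symfun b f -> exists P, series (psum_eval P) = f.
Proof.
move=> fS.
have [L fL] : exists L, forall m, coef f m != 0 -> (ns m < L)%N.
  have [[d fd] _ _] := fS; exists d.+1 => m /fd; rewrite ltnS.
  exact: leq_trans (ns_mdeg m).
elim: L f fS fL => [|L IH] f fS fL.
  exists 0; rewrite (_ : psum_eval 0 = 0); last first.
    by rewrite -[X in psum_eval X](subrr 0) psum_evalB subrr.
  by apply: fpsP => m; apply/esym/eqP; apply/negP => /negP /fL.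
have [[d fd] fb _] := fS.
pose top : {cmonom var} := [cmonom d | _ in
  [fset x | x in [seq (c, j) | c <- [:: false; true], j <- iota 0 d]]%fset]%M.
pose good (w : {cmonom var}) :=
  (mdeg w == L) && all (fun v => v.1 == b) (finsupp w).
pose D : {fset {cmonom var}} :=
  fset_set [set u : {cmonom var} | exists v : {cmonom var}, (u * v)%M = top].
pose S := [fset w in D | good w]%fset.
pose rep w := projT1 (cid (ex_ty w)).
have repP w : ty (rep w) = w by rewrite /rep; case: cid.
pose c w := coef f (rep w) / coef (E w) (rep w).
pose P0 : ppoly := \sum_(w <- S) << c w *g w >>.
have P0E' : series (psum_eval P0) = \sum_(w <- S) c w *: E w.
  rewrite (big_morph psum_eval psum_evalD (id1 := 0)); last first.
    by rewrite -[X in psum_eval X](subrr 0) psum_evalB subrr.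
  under eq_bigr => w _ do rewrite psum_evalU.
  exact: (raddf_sum (\val : Lambda -> fps var)).
have P0E m : coef (series (psum_eval P0)) m = \sum_(w <- S) c w * coef (E w) m.
  by rewrite P0E' coef_sum.
have Sgood w : w \in S -> good w by rewrite !inE => /andP[].
have tyS m : coef f m != 0 -> ns m = L -> ty m \in S.
  move=> fm nm; have tym v : v \in finsupp (ty m) -> v.1 = b /\ (v.2 < d)%N.
    case: v => x j /in_ty [v vm [<- mv]]; split; first exact: fb vm.
    by rewrite /= -mv (leq_trans (le_mdeg m v)) // fd.
  have tyd v : (ty m v <= d)%N.
    apply: leq_trans (le_mdeg (ty m) v) _.
    by rewrite ty_deg; exact: leq_trans (ns_mdeg m) (fd m fm).
  rewrite !inE /good ty_deg nm eqxx /=; apply/andP; split; last first.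
    by apply/allP => v /tym [->].
  rewrite in_fset_set; last exact: finite_divisors.
  apply/mem_set; exists (divcm top (ty m)); apply/eqP/cmP => v.
  rewrite cmM divcmE subnKC // cmE fsfun_fun.
  case: ifPn => [_|]; first exact: tyd.
  apply: contraR; rewrite -ltnNge => v0; have [|_ vd] := tym v.
    by rewrite -cmE_neq0 -lt0n.
  apply/imfsetP; exists v => //; apply/allpairsP; exists v.
  split; rewrite ?mem_iota //.
    by case: (v.1).
  exact: surjective_pairing.
have P0S : is_symfun b (series (psum_eval P0)).
  rewrite P0E' big_seq; elim/big_ind: _ => [|f1 g1|w /Sgood /andP[_ /allP wb]].
  - by rewrite -(scale0r 1); apply: symfunZ; exact: symfun1.
  - exact: symfunD.
  - by apply: symfunZ; apply: symfun_E => v /wb /eqP.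
pose f' := f - series (psum_eval P0).
have f'S : is_symfun b f' by apply: symfunD => //; rewrite -scaleN1r; exact: symfunZ.
have coef_f' m : coef f' m = coef f m - coef (series (psum_eval P0)) m by [].
have [|P PE] := IH f' f'S; last first.
  exists (P + P0); rewrite psum_evalD.
  by rewrite -[LHS]/(series (psum_eval P) + series (psum_eval P0)) PE subrK.
move=> m nz; have /orP[lt|/eqP nm] : (ns m < L)%N || (ns m == L).
- rewrite orbC -leq_eqVlt; apply: contraNT nz; rewrite -ltnNge => lt.
  rewrite coef_f' P0E big_seq big1 => [|w /Sgood /andP[/eqP wL _]].
    rewrite subr0; apply/eqP/eqP; apply/negPn/negP => /fL.
    by rewrite ltnS leqNgt lt.
  by have [_ -> //] := E_spec m wL; rewrite mulr0.
- by [].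
case/negP: nz; rewrite coef_f' P0E subr_eq0.
have other w : w \in S -> w != ty m -> c w * coef (E w) m = 0.
  move=> /Sgood /andP[/eqP wL _] ne; have [_ _ /(_ nm)] := E_spec m wL.
  by rewrite [ty m == _]eq_sym (negbTE ne) => /negbFE/eqP ->; rewrite mulr0.
have [tS|tS] := boolP (ty m \in S); last first.
  rewrite big_seq big1 => [|w wS]; last first.
    by apply: other => //; apply: contraNneq tS => <-.
  by apply: contraNT tS => fm; exact: tyS.
rewrite (big_fsetD1 (ty m)) //= [X in _ + X]big_seq big1 => [|w]; last first.
  by rewrite in_fsetD1 => /andP[ne wS]; exact: other.
have /andP[/eqP tL /allP tb] := Sgood _ tS.
have mb v : v \in finsupp m -> v.1 = b.
  case: v => e i vm; have /tb /eqP // : (e, (m (e, i)).-1) \in finsupp (ty m).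
  by rewrite (ty_rm vm) mdomD mdomU !inE eqxx.
have ES : is_symfun b (E (ty m)) by apply: symfun_E => v /tb /eqP.
have rm_ty : ty m = ty (rep (ty m)) by rewrite repP.
rewrite addr0 /c (symfun_ty fS rm_ty mb) (symfun_ty ES rm_ty mb) divfK //.
by have [_ _ /(_ nm) ->] := E_spec m tL.
Qed.

Lemma psum_eval_surj (f : Lambda) : exists P, psum_eval P = f.
Proof.
case: f => f fS; have /asboolP [r hr fE] := fS.
suff [P PE] : exists P, series (psum_eval P) = f by exists P; exact: seriesP.
rewrite fE big_seq.
elim/big_ind: _ => [|x y [P <-] [Q <-]|q /hr [/symfun_eval [P PE] /symfun_eval [Q QE]]].
- exists 0; rewrite (_ : psum_eval 0 = 0) //.
  by rewrite -[X in psum_eval X](subrr 0) psum_evalB subrr.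
- by exists (P + Q); rewrite psum_evalD.
- by exists (P * Q); rewrite psum_evalM -PE -QE.
Qed.

Lemma psum_coordK : cancel psum_coord psum_eval.
Proof. by move=> f; rewrite /psum_coord; case: xgetP => // /(_ _ _) /= no; have [P /no] := psum_eval_surj f. Qed.

Lemma psum_evalK : cancel psum_eval psum_coord.
Proof. by move=> P; apply: psum_eval_inj; rewrite psum_coordK. Qed.
End PowerSumBasis.

Definition V : Type := fps var.
HB.instance Definition _ := GRing.ComAlgebra.on V.

Definition F (f : Lambda) : V := Fps (fun w => (psum_coord f)@_w).

Section FMorphism.

Let emb (P : ppoly) : V := Fps (fun w => P@_w).

Let embM P Q : emb (P * Q) = emb P * emb Q.
Proof.
apply: fpsP => m; rewrite coefM /= mcoeffMl.
pose r := [seq u <- [seq (a, b) | a <- msupp P, b <- msupp Q] |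
           (u.1 * u.2)%M == m].
rewrite (fsbigE r).
- rewrite [RHS]big_mkcond big_filter [RHS]big_mkcond big_allpairs.
  apply: eq_bigr => u _; apply: eq_bigr => v _ /=; case: eqP => // e.
  by rewrite mem_set.
- apply: filter_uniq; apply: allpairs_uniq => //; try exact: fset_uniq.
  by move=> [? ?] [? ?].
- by move=> u /=; rewrite mem_filter => /andP[/eqP].
- move=> [u v] /= e; rewrite mem_filter /= e eqxx /= => ne.
  have [uP|uP] := boolP (u \in msupp P); last by rewrite mcoeff_outdom ?mul0r.
  have [vQ|vQ] := boolP (v \in msupp Q).
    by case/negP: ne; apply/allpairsP; exists (u, v).
  by rewrite [X in _ * X]mcoeff_outdom ?mulr0.
Qed.

Let F_eval P : F (psum_eval P) = emb P.
Proof. by rewrite /F psum_evalK. Qed.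

Let F_zmod_morphism : zmod_morphism F.
Proof.
move=> f g; rewrite -(psum_coordK f) -(psum_coordK g) -psum_evalB !F_eval.
by apply: fpsP => w; rewrite /= mcoeffB.
Qed.

Let F_monoid_morphism : monoid_morphism F.
Proof.
split=> [|f g].
  by rewrite -psum_eval1 F_eval; apply: fpsP => w; rewrite /= mcoeff1.
by rewrite -(psum_coordK f) -(psum_coordK g) -psum_evalM !F_eval embM.
Qed.

Let F_scalable : scalable F.
Proof.
move=> c f; rewrite -(psum_coordK f) -psum_evalZ !F_eval.
by apply: fpsP => w; rewrite /= mcoeffZ.
Qed.

HB.instance Definition _ := GRing.isZmodMorphism.Build Lambda V F F_zmod_morphism.
HB.instance Definition _ := GRing.isMonoidMorphism.Build Lambda V F F_monoid_morphism.
HB.instance Definition _ := GRing.isScalable.Build rat Lambda V *:%R F F_scalable.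

Lemma F_psum b k : (0 < k)%N ->
  F (psum b k) = Fps (fun w => (w == ucm (b, k.-1))%:R).
Proof.
case: k => // k _; have -> : psum b k.+1 = psum_eval << ucm (b, k) >>.
  by rewrite psum_evalU scale1r /psum_mon mdomU big_seq_fset1 cmUU.
by rewrite F_eval; apply: fpsP => w; rewrite /= mcoeffU1 eq_sym.
Qed.
End FMorphism.

Definition ppoly_deriv (v : var) (P : ppoly) : ppoly :=
  \sum_(w <- msupp P) << (w v)%:R * P@_w *g divcm w (ucm v) >>.

(* [dV b k] and [dLambda b k] are the partial derivatives in the k-th power sum
   variable of alphabet [b], for k > 0. *)
Definition dV (b : bool) (k : nat) (f : V) : V :=
  Fps (fun w => (w (b, k.-1)).+1%:R * coef f (w * ucm (b, k.-1))%M).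

Definition dLambda (b : bool) (k : nat) (f : Lambda) : Lambda :=
  psum_eval (ppoly_deriv (b, k.-1) (psum_coord f)).

Lemma F_dLambda b k f : F (dLambda b k f) = dV b k (F f).
Proof.
apply: fpsP => w; rewrite /= /dLambda psum_evalK; set v := (b, k.-1).
move: (psum_coord f) => P; rewrite /ppoly_deriv raddf_sum /=.
have [vP|vP] := boolP ((w * ucm v)%M \in msupp P); last first.
  rewrite (mcoeff_outdom vP) mulr0 big_seq big1 // => u uP.
  rewrite mcoeffU; case: eqP => [e|_] //; have [u0|u0] := posnP (u v).
    by rewrite u0 mul0r.
  case/negP: vP; rewrite (_ : (w * _)%M = u) //; apply/eqP/cmP => x.
  rewrite -e cmM divcmE cmU; case: (v =P x) => [<-|_]; last by rewrite subn0 addn0.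
  by rewrite subnK.
have wE : divcm (w * ucm v)%M (ucm v) = w.
  by apply/eqP/cmP => x; rewrite divcmE cmM addnK.
rewrite (big_fsetD1 (w * ucm v)%M) //= big_seq big1 => [|u].
  by rewrite addr0 mcoeffU wE eqxx cmM cmUU addn1.
rewrite in_fsetD1 => /andP[ne uP]; rewrite mcoeffU.
case: eqP => [e|_] //; have [u0|u0] := posnP (u v); first by rewrite u0 mul0r.
case/eqP: ne; apply/eqP/cmP => x; rewrite -e cmM divcmE cmU.
by case: (v =P x) => [<-|_]; rewrite ?subn0 ?addn0 ?subnK.
Qed.

Section Delta.
Context (U : lmodType rat) (d : bool -> nat -> U -> U).

Definition Delta_factor (n k : nat) (f : U) : U :=
  \sum_(i < n.+1) (k%:R ^+ i / i`!%:R) *: iter i (d false k \o d true k) f.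

Definition Delta_trunc (K n : nat) : U -> U :=
  \big[@comp U U U/id]_(1 <= k < K.+1) Delta_factor n k.

(* The value at which the truncations stabilize; on polynomials in the power
   sums they do, as only finitely many terms of the expansion are nonzero. *)
Definition Delta (f : U) : U :=
  xget 0 [set g | exists N, forall K n, (N <= K)%N -> (N <= n)%N ->
                  Delta_trunc K n f = g].
End Delta.

Definition is_partition (l : seq nat) : bool := sorted geq l.

(* 1-based, and extended by zeros *)
Definition part (l : seq nat) (i : nat) : nat := nth 0%N l i.-1.

(* The ordinals [i], [j] are the row and column indices minus one; the infinite
   sum over k has finite support because [hsym] vanishes in negative degree. *)
Definition bTW (d : nat) (l m : seq nat) : Lambda :=
  \det (\matrix_(i < d, j < d)
    \sum_(k \in [set k : nat | (1 <= k)%N])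
      hsym true (i.+1%:Z - k%:Z + (part m (d - i.+1 + 1))%:Z) *
      hsym false (j.+1%:Z - k%:Z + (part l (d - j.+1 + 1))%:Z)).

Definition TW (d : nat) (l m : seq nat) : V := F (bTW d l m).

(* Main.v *)
(* The product of two Jacobi-Trudi determinants is expanded along monomials
   x^s y^t in the shift variables x_j, y_i, where x^s y^t stands for
   prod_j h_(a_j - s_j) prod_i h~_(b_i - t_i) with a_j = j + lambda_(d-j+1) and
   b_i = i + mu_(d-i+1): it is the image of the Weyl numerator
   det(x_j^k) det(y_i^k).  Since d h_n / d p_k = h_(n-k) / k, the operator
   k d_(p_k) d_(p~_k) becomes multiplication by p_k[x_j y_i] / k, so that Delta
   becomes multiplication by exp(sum_k p_k[x_j y_i] / k), that is, by the Cauchy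
   kernel prod_(i,j) 1 / (1 - x_j y_i).  By Cauchy's determinant the result is
   det(x_j y_i / (1 - x_j y_i)), whose image is TW^(lambda mu).  Monomials of
   high degree are sent to 0, so everything may be done modulo such monomials. *)
From HB Require Import structures.
Require Import Defs.
From mathcomp Require Import all_boot all_order all_algebra.
From mathcomp Require Import fingroup perm finmap boolp classical_sets fsbigop.
From mathcomp Require Import monalg ring zify.

Set Implicit Arguments.
Unset Strict Implicit.
Unset Printing Implicit Defensive.

Import GRing.Theory Num.Theory.
Local Open Scope ring_scope.

Local Notation "1" := (@mone _) : monom_scope.
Local Notation "x * y" := (mmul x y) : monom_scope.

(** * Cauchy's determinant *)

(** One step of Gaussian elimination: a unitriangular block matrix on the left clears the first
    column. The inverse [u] of the pivot is an argument, so any commutative ring will do. *)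
Lemma det_schur (R : comNzRingType) n (A : 'M[R]_n.+1) (u : R) :
  A 0 0 * u = 1 ->
  \det A = A 0 0 * \det (\matrix_(i, j)
    (A (lift 0 i) (lift 0 j) - A (lift 0 i) 0 * u * A 0 (lift 0 j))).
Proof.
move=> Au; pose B : 'M[R]_(1 + n) := A.
pose L : 'M[R]_(1 + n) := block_mx 1%:M 0 (- (u *: dlsubmx B)) 1%:M.
have LB : L *m B = block_mx (ulsubmx B) (ursubmx B) 0
    (drsubmx B - u *: (dlsubmx B *m ursubmx B)).
  rewrite -{1}[B]submxK mulmx_block !mul1mx !mul0mx !addr0 !mulNmx -!scalemxAl.
  congr block_mx; last by rewrite addrC.
  rewrite [ulsubmx B]mx11_scalar mul_mx_scalar scalerA.
  suff -> : u * ulsubmx B 0 0 = 1 by rewrite scale1r addrC subrr.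
  by rewrite !mxE !lshift0 mulrC.
have <- : \det (L *m B) = \det A.
  by rewrite det_mulmx det_lblock !det1 !mul1r.
rewrite LB det_ublock det_mx11 !mxE !lshift0; congr (_ * \det _).
apply/matrixP => i j; rewrite !mxE big_ord1 !mxE !lshift0 !rshift1.
by rewrite mulrCA mulrA.
Qed.

Lemma det_scale_rows_cols (R : comNzRingType) n (f g : 'I_n -> R) (A : 'M[R]_n) :
  \det (\matrix_(i, j) (f i * g j * A i j)) =
  (\prod_i f i) * (\prod_j g j) * \det A.
Proof.
rewrite (_ : matrix_of_fun _ _ =
    diag_mx (\row_i f i) *m A *m diag_mx (\row_j g j)).
  rewrite !det_mulmx !det_diag mulrAC.
  by congr (_ * _ * _); apply: eq_bigr => i _; rewrite mxE.
by apply/matrixP => i j; rewrite mul_mx_diag mul_diag_mx !mxE mulrAC.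
Qed.

Lemma det_Vandermonde_recl (R : comNzRingType) d (x : 'I_d.+1 -> R) :
  \det (Vandermonde d.+1 (\row_i x i)) =
  (\prod_j (x (lift 0 j) - x 0)) * \det (Vandermonde d (\row_i x (lift 0 i))).
Proof.
rewrite !det_Vandermonde big_ord_recl; congr (_ * _).
  by rewrite big_mkcond big_ord_recl /= mul1r; apply: eq_bigr => j _; rewrite !mxE.
apply: eq_bigr => i _; rewrite big_mkcond big_ord_recl /= mul1r -big_mkcond.
by apply: eq_bigr => j _; rewrite !mxE.
Qed.

(** Induction on [d]. The Schur complement of the corner entry has entries
    [(y_i - y_0) (x_j - x_0) c_i0 c_0j c_ij]; the row and column factors come out of the determinant
    and leave a smaller Cauchy matrix. *)
Lemma det_Cauchy (R : comNzRingType) d (x y : 'I_d -> R) (c : 'I_d -> 'I_d -> R) :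
  (forall i j, c i j * (1 - x j * y i) = 1) ->
  \det (\matrix_(i, j) c i j) =
  \det (Vandermonde d (\row_i x i)) * \det (Vandermonde d (\row_i y i)) *
  \prod_i \prod_j c i j.
Proof.
elim: d x y c => [|d IH] x y c cE; first by rewrite !det_mx00 !big_ord0 !mulr1.
pose D i j : R := 1 - x j * y i.
have cD i j : c i j * D i j = 1 by [].
rewrite (@det_schur _ _ _ (D 0 0)) ?mxE //.
transitivity (c 0 0 * \det (\matrix_(i, j)
  (((y (lift 0 i) - y 0) * c (lift 0 i) 0) * ((x (lift 0 j) - x 0) * c 0 (lift 0 j))
   * (\matrix_(i, j) c (lift 0 i) (lift 0 j)) i j))).
  congr (_ * \det _); apply/matrixP => i j; rewrite !mxE.
  move: (lift 0 i) (lift 0 j) => {}i {}j.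
  (* Inserting factors [c * D = 1] gives both terms the common factor [c i j * c i 0 * c 0 j]; what
     remains is a polynomial identity. *)
  transitivity (c i j * (c i 0 * D i 0) * (c 0 j * D 0 j)
     - c i 0 * (c i j * D i j) * D 0 0 * c 0 j); first by rewrite !cD !mulr1.
  by rewrite /D; ring.
rewrite det_scale_rows_cols (IH (x \o lift 0) (y \o lift 0)) //.
rewrite !det_Vandermonde_recl !big_split big_ord_recl [in RHS]big_ord_recl.
under [in X in _ = _ * (_ * X)]eq_bigr do rewrite big_ord_recl.
rewrite big_split /=; ring.
Qed.

Lemma Cauchy_kernel (R : comNzRingType) d (x y : 'I_d -> R)
    (c : 'I_d -> 'I_d -> R) (T : R) :
  (forall i j, c i j * (1 - x j * y i) = 1) ->
  T * \prod_(e : 'I_d * 'I_d) (1 - x e.1 * y e.2) = 1 ->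
  \det (\matrix_(j < d, k < d) x j ^+ k.+1) *
  \det (\matrix_(i < d, k < d) y i ^+ k.+1) * T =
  \det (\matrix_(i, j) (x j * y i * c i j)).
Proof.
move=> cE TE.
have Vx (z : 'I_d -> R) : \det (\matrix_(j < d, k < d) z j ^+ k.+1) =
    \prod_j z j * \det (Vandermonde d (\row_j z j)).
  rewrite -[in RHS]det_tr.
  have := det_scale_rows_cols z (fun=> 1) (Vandermonde d (\row_j z j))^T.
  rewrite big1_eq mulr1 => <-; congr (\det _); apply/matrixP => i j.
  by rewrite !mxE exprS mulr1.
(* Both sides are inverse to the product of all [1 - x_j y_i]. *)
have -> : T = \prod_i \prod_j c i j.
  transitivity (T * (\prod_(e : 'I_d * 'I_d) (1 - x e.1 * y e.2) *
    \prod_i \prod_j c i j)); last by rewrite mulrA TE mul1r.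
  rewrite -[LHS]mulr1; congr (_ * _).
  have -> : \prod_e (1 - x e.1 * y e.2) = \prod_i \prod_j (1 - x j * y i).
    by rewrite exchange_big pair_bigA.
  transitivity (\prod_i \prod_j ((1 - x j * y i) * c i j)).
    by rewrite big1 // => i _; rewrite big1 // => j _; rewrite mulrC.
  by under eq_bigr do rewrite big_split; rewrite big_split.
have := det_scale_rows_cols y x (\matrix_(i, j) c i j).
rewrite (det_Cauchy cE) !Vx => h.
transitivity (\prod_i y i * \prod_j x j * (\det (Vandermonde d (\row_i x i)) *
   \det (Vandermonde d (\row_i y i)) * \prod_i \prod_j c i j)); first by ring.
rewrite -h; congr (\det _); apply/matrixP => i j; rewrite !mxE.
by rewrite [y i * _]mulrC.
Qed.

(** In the quotient by [J] the products [x_j y_i] are nilpotent, so the geometric sum cut at [N] is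
    an exact inverse of [1 - x_j y_i] and [Cauchy_kernel] applies. *)
Lemma Cauchy_kernel_mod (R : comNzRingType) (J : idealr R) d (x y : 'I_d -> R) N T :
  (forall i j, (x j * y i) ^+ N \in J) ->
  T * \prod_(e : 'I_d * 'I_d) (1 - x e.1 * y e.2) - 1 \in J ->
  \det (\matrix_(j < d, k < d) x j ^+ k.+1) *
  \det (\matrix_(i < d, k < d) y i ^+ k.+1) * T -
  \det (\matrix_(i < d, j < d) \sum_(k < N) (x j * y i) ^+ k.+1) \in J.
Proof.
move=> xyJ TJ; pose p : {rmorphism R -> {ideal_quot J}} := \pi_{ideal_quot J}%qT.
have pE u v : (u - v \in J) = (p u == p v) by exact: Quotient.idealrBE.
move: TJ; rewrite !pE rmorph1 rmorphM rmorph_prod => /eqP TE; apply/eqP.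
rewrite !rmorphM -!det_map_mx.
pose c i j := \sum_(k < N) (p (x j) * p (y i)) ^+ k.
have xyN i j : (p (x j) * p (y i)) ^+ N = 0.
  by rewrite -rmorphM -rmorphXn; apply/eqP; rewrite -[0](rmorph0 p) -pE subr0.
have cE i j : c i j * (1 - p (x j) * p (y i)) = 1.
  by rewrite mulrC -opprB mulNr -subrX1 xyN sub0r opprK.
have TE' : p T * \prod_(e : 'I_d * 'I_d) (1 - p (x e.1) * p (y e.2)) = 1.
  rewrite -[RHS]TE; congr (_ * _); apply: eq_bigr => e _.
  by rewrite rmorphB rmorph1 rmorphM.
have h := Cauchy_kernel cE TE'.
have mxX (f : 'I_d -> R) : map_mx p (\matrix_(j < d, k < d) f j ^+ k.+1) =
    \matrix_(j < d, k < d) p (f j) ^+ k.+1.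
  by apply/matrixP => j k; rewrite !mxE rmorphXn.
rewrite !mxX; apply: etrans h _.
congr (\det _); apply/matrixP => i j; rewrite !mxE rmorph_sum mulr_sumr.
by apply: eq_bigr => k _; rewrite rmorphXn rmorphM exprS.
Qed.

(** * Truncated exponentials and geometric series *)

Lemma linear_leibnizl (R : comNzRingType) (A : algType R) (D : {linear A -> A}) Q :
  linear (fun P => D P * Q + P * D Q).
Proof.
by move=> c x y; rewrite linearP !mulrDl -!scalerAl addrACA -scalerDr.
Qed.

Lemma linear_leibnizr (R : comNzRingType) (A : algType R) (D : {linear A -> A}) P :
  linear (fun Q => D P * Q + P * D Q).
Proof.
by move=> c x y; rewrite linearP !mulrDr -!scalerAr addrACA -scalerDr.
Qed.

Section TruncatedExponential.
Context (A : comAlgType rat) (D : {linear A -> A}) (J : submodClosed A).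
Hypothesis DM : forall P Q, D (P * Q) = D P * Q + P * D Q.
Hypothesis JM : forall P Q, Q \in J -> P * Q \in J.
Implicit Types (P Q f g : A).

Let D1 : D 1 = 0.
Proof.
have := DM 1 1; rewrite !mulr1 mul1r => /(congr1 (+%R (- D 1))).
by rewrite addNr addKr.
Qed.

Lemma derivationX P (c : rat) k : D P = c *: P -> D (P ^+ k) = (c * k%:R) *: P ^+ k.
Proof.
move=> hP; elim: k => [|k IH]; first by rewrite mulr0 scale0r expr0 D1.
by rewrite exprS DM IH hP -scalerAl -scalerAr -scalerDl -natr1 mulrDr mulr1 addrC.
Qed.

(* [log_deriv P g]: modulo [J], [g] is the logarithmic derivative of [P]. *)
Let log_deriv P g := D P - P * g \in J.

Let log_derivM P Q f g : log_deriv P f -> log_deriv Q g -> log_deriv (P * Q) (f + g).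
Proof.
move=> hP hQ; rewrite /log_deriv DM.
have -> : D P * Q + P * D Q - P * Q * (f + g) =
  Q * (D P - P * f) + P * (D Q - Q * g) by ring.
by rewrite rpredD ?JM.
Qed.

Let log_deriv_prod (E : Type) (r : seq E) (h : pred E) (P g : E -> A) :
  (forall e, h e -> log_deriv (P e) (g e)) ->
  log_deriv (\prod_(e <- r | h e) P e) (\sum_(e <- r | h e) g e).
Proof.
move=> hP; apply: (big_ind2 log_deriv) => //; last by move=> *; exact: log_derivM.
by rewrite /log_deriv mulr0 subr0 D1 rpred0.
Qed.

Definition exp_trunc n (v : A) : A := \sum_(i < n.+1) i`!%:R^-1 *: v ^+ i.

(** Meant for the constant coefficient: only the term [i = 0] of the exponential survives. *)
Lemma rmorph_exp_trunc (f : {rmorphism A -> rat}) n v :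
  (forall c w, f (c *: w) = c * f w) -> f v = 0 -> f (exp_trunc n v) = 1.
Proof.
move=> fZ v0; rewrite rmorph_sum big_ord_recl fZ expr0 rmorph1 mulr1 fact0 invr1.
by rewrite big1 ?addr0 // => i _; rewrite fZ rmorphXn /= v0 expr0n mulr0.
Qed.

(** The two sums agree term by term after a shift of the index by one; the unmatched last term is a
    multiple of [u ^+ n.+1]. *)
Let log_deriv_exp n (c : rat) u : D u = c *: u -> u ^+ n.+1 \in J ->
  log_deriv (exp_trunc n u) (c *: u).
Proof.
move=> Du uJ; rewrite /log_deriv.
have -> : D (exp_trunc n u) - exp_trunc n u * (c *: u) =
    - ((c * n`!%:R^-1) *: u ^+ n.+1).
  rewrite -scalerAr mulr_suml linear_sum /=.
  rewrite big_ord_recl linearZ /= (derivationX _ Du) mulr0 scale0r scaler0 add0r.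
  rewrite scaler_sumr [X in _ - X]big_ord_recr /= opprD addrA.
  rewrite -sumrB big1 ?add0r => [|i _].
    by rewrite -scalerAl -exprSr scalerA.
  rewrite linearZ /= (derivationX _ Du) -scalerAl -exprSr !scalerA /bump add1n.
  rewrite factS natrM.
  apply/eqP; rewrite subr_eq0; apply/eqP; congr (_ *: _).
  have i0 : i.+1%:R != 0 :> rat by rewrite pnatr_eq0.
  have f0 : i`!%:R != 0 :> rat by rewrite pnatr_eq0 -lt0n fact_gt0.
  by field; rewrite f0 nat1r.
by rewrite -scaleNr rpredZ.
Qed.

(** The exact logarithmic derivative is [- c x / (1 - x)]; cutting the geometric series costs a
    multiple of [x ^+ K.+1]. *)
Let log_deriv_geom K (c : rat) x : D x = c *: x -> x ^+ K.+1 \in J ->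
  log_deriv (1 - x) (- (c *: \sum_(1 <= k < K.+1) x ^+ k)).
Proof.
move=> Dx xJ; rewrite /log_deriv.
have -> : D (1 - x) - (1 - x) * (- (c *: \sum_(1 <= k < K.+1) x ^+ k)) =
    - (c *: x ^+ K.+1).
  have geo : (1 - x) * \sum_(1 <= k < K.+1) x ^+ k = x - x ^+ K.+1.
    rewrite big_add1 /= mulr_sumr.
    under eq_bigr do rewrite mulrBl mul1r -exprS -opprB.
    by rewrite sumrN telescope_sumr // opprB expr1.
  rewrite linearB /= D1 sub0r Dx mulrN opprK -scalerAr geo scalerBr.
  by rewrite addrA addNr sub0r.
by rewrite -scaleNr rpredZ.
Qed.

(* [exp (sum_k p_k / k)] and [1 / prod_e (1 - z_e)], with [p_k] the power sums of
   the [z_e], have the same logarithmic derivative. *)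
Lemma derivation_exp_geom (E : finType) (z : E -> A) (c : rat) (K n : nat) :
  let u k := k%:R^-1 *: \sum_e z e ^+ k in
  (forall e, D (z e) = c *: z e) -> (forall e, z e ^+ K.+1 \in J) ->
  (forall k, (0 < k)%N -> u k ^+ n.+1 \in J) ->
  D ((\prod_(1 <= k < K.+1) exp_trunc n (u k)) * \prod_e (1 - z e)) \in J.
Proof.
move=> u Dz zJ uJ.
have Du k : (0 < k)%N ->
    D (u k) = (c * k%:R) *: u k /\ (c * k%:R) *: u k = c *: \sum_e z e ^+ k.
  move=> k0; have kN0 : k%:R != 0 :> rat by rewrite pnatr_eq0 -lt0n.
  split; last by rewrite scalerA -mulrA divff // mulr1.
  rewrite /u linearZ /= linear_sum /= scalerA [in RHS]mulrC -scalerA; congr (_ *: _).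
  by rewrite scaler_sumr; apply: eq_bigr => e _; rewrite (derivationX _ (Dz e)).
have hT : log_deriv (\prod_(1 <= k < K.+1) exp_trunc n (u k))
                    (\sum_(1 <= k < K.+1) c *: \sum_e z e ^+ k).
  rewrite !big_add1 /=; apply: log_deriv_prod => k _.
  have [Duk <-] := Du k.+1 isT; apply: log_deriv_exp => //; exact: uJ.
have hG : log_deriv (\prod_e (1 - z e))
                    (\sum_e - (c *: \sum_(1 <= k < K.+1) z e ^+ k)).
  by apply: log_deriv_prod => e _; apply: log_deriv_geom.
(* The two logarithmic derivatives cancel once the sums over [k] and [e] are exchanged. *)
have := log_derivM hT hG.
by rewrite sumrN -!scaler_sumr exchange_big subrr /log_deriv mulr0 subr0.
Qed.

End TruncatedExponential.

(** * Linear maps determined by their values on a basis *)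

(* Sealed, because unification would otherwise unfold finitely supported
   functions. *)
HB.lock Definition mon (K : choiceType) (w : K) : {malg rat[K]} := << w >>.

HB.lock Definition mlin (K : choiceType) (U : lmodType rat) (W : K -> U)
  (P : {malg rat[K]}) : U := \sum_(w <- msupp P) P@_w *: W w.

Section LinearExtension.
Context (K : choiceType).
Implicit Types (P Q : {malg rat[K]}) (w : K).

Lemma monE w : mon w = << w >>. Proof. by rewrite mon.unlock. Qed.

Lemma mcoeff_mon w x : (mon w)@_x = (w == x)%:R.
Proof. by rewrite monE mcoeffU. Qed.

Lemma malg_lin_ind (S : {malg rat[K]} -> Prop) :
  S 0 -> (forall c w P, S P -> S (c *: mon w + P)) -> forall P, S P.
Proof.
move=> S0 SD P; rewrite (monalgE P); elim: (enum_fset _) => [|w r IH].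
  by rewrite big_nil.
rewrite big_cons -[<< P@_w *g w >>](_ : P@_w *: mon w = _); first exact: SD.
by apply/malgP => x; rewrite mcoeffZ mcoeff_mon mcoeffU mulr_natr.
Qed.

Lemma malg_lin_eq (U : lmodType rat) (f g : {malg rat[K]} -> U) :
  linear f -> linear g -> (forall w, f (mon w) = g (mon w)) -> f =1 g.
Proof.
move=> fL gL fg.
have lin0 (h : {malg rat[K]} -> U) : linear h -> h 0 = 0.
  by move=> hL; have := hL (-1) 0 0; rewrite scaler0 addr0 scaleN1r addNr.
elim/malg_lin_ind => [|c w P IH]; first by rewrite !lin0.
by rewrite fL gL fg IH.
Qed.

Context (U : lmodType rat) (W : K -> U).

Lemma mlinEw (D : {fset K}) P : (msupp P `<=` D)%fset ->
  mlin W P = \sum_(w <- D) P@_w *: W w.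
Proof.
move=> le; rewrite mlin.unlock; apply: big_fset_incl => // w _ wP.
by rewrite mcoeff_outdom // scale0r.
Qed.

Fact mlin_is_linear : linear (mlin W).
Proof.
move=> c P Q; pose D := (msupp P `|` msupp Q `|` msupp (c *: P + Q))%fset.
rewrite (@mlinEw D) ?fsubsetUr // (@mlinEw D P) 1?(@mlinEw D Q); first last.
- by rewrite (fsubset_trans _ (fsubsetUl _ _)) // fsubsetUl.
- by rewrite (fsubset_trans _ (fsubsetUl _ _)) // fsubsetUr.
rewrite scaler_sumr -big_split; apply: eq_bigr => w _ /=.
by rewrite mcoeffD mcoeffZ scalerDl scalerA.
Qed.
HB.instance Definition _ :=
  GRing.isLinear.Build rat {malg rat[K]} U *:%R (mlin W) mlin_is_linear.

Lemma mlinU w : mlin W (mon w) = W w.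
Proof. by rewrite monE mlin.unlock msuppU oner_eq0 big_seq_fset1 mcoeffUU scale1r. Qed.

End LinearExtension.

(** * The degree filtration and the inverse of the Cauchy kernel modulo high degree *)

Section LowestDegree.
Context (I : choiceType).
Local Notation A := {malg rat[{cmonom I}]}.
Implicit Types (P Q f g : A) (w : {cmonom I}).

(** The Euler operator. In characteristic zero it kills the constants only, so a polynomial is known
    from its image and its constant coefficient. *)
Definition euler : A -> A := mlin (fun w => (mdeg w)%:R *: mon w).

Fact euler_linear : linear euler.
Proof. exact: linearP. Qed.
HB.instance Definition _ := GRing.isLinear.Build rat A A *:%R euler euler_linear.

Lemma eulerU w : euler (mon w) = (mdeg w)%:R *: mon w.
Proof. exact: mlinU. Qed.

Lemma monM w w' : (mon w : A) * mon w' = mon (w * w')%M.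
Proof. by rewrite !monE malgM_def fgmulUU mulr1. Qed.

Lemma eulerM P Q : euler (P * Q) = euler P * Q + P * euler Q.
Proof.
apply: (malg_lin_eq (f := fun P => euler (P * Q))
  (g := fun P => euler P * Q + P * euler Q)) => [c x y||w].
- by rewrite mulrDl -scalerAl; exact: euler_linear.
- exact: linear_leibnizl.
apply: (malg_lin_eq (f := fun Q => euler (mon w * Q))
  (g := fun Q => euler (mon w) * Q + mon w * euler Q)) => [c x y||w'].
- by rewrite mulrDr -scalerAr; exact: euler_linear.
- exact: linear_leibnizr.
rewrite monM [X in X = _]eulerU mdegM natrD scalerDl -monM.
by congr (_ + _); rewrite eulerU; [exact: scalerAl | exact: scalerAr].
Qed.

Lemma mcoeff_euler P w : (euler P)@_w = (mdeg w)%:R * P@_w.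
Proof.
apply: (malg_lin_eq (U := rat^o) (f := fun P => (euler P)@_w)
                    (g := fun P => (mdeg w)%:R * P@_w)) => [c x y|c x y|w'].
- by rewrite euler_linear mcoeffD mcoeffZ.
- by rewrite mcoeffD mcoeffZ mulrDr mulrCA.
rewrite eulerU mcoeffZ mcoeff_mon.
by case: eqP => [->|_]; rewrite ?mulr0.
Qed.

(** The [a]-th power of the ideal of polynomials without constant term; congruence modulo it
    replaces convergence of power series. *)
Definition ord_ge (a : nat) : {pred A} :=
  fun P => all (fun w => (a <= mdeg w)%N) (msupp P).

Lemma ord_geP a P : reflect (forall w, (mdeg w < a)%N -> P@_w = 0) (P \in ord_ge a).
Proof.
apply: (iffP allP) => h w => [lt|]; last first.
  by rewrite -mcoeff_neq0 leqNgt; apply: contra => /h ->.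
by apply: mcoeff_outdom; apply/negP => /h; rewrite leqNgt lt.
Qed.

Lemma ord_geM a b P Q : P \in ord_ge a -> Q \in ord_ge b -> P * Q \in ord_ge (a + b).
Proof.
move=> /ord_geP hP /ord_geP hQ; apply/ord_geP => w lt.
rewrite mcoeffMl big1 // => u _; rewrite big1 // => v _.
have [ua|au] := ltnP (mdeg u) a; first by rewrite hP // mul0r mul0rn.
case: eqP => // wE; rewrite mulr1n.
rewrite hQ ?mulr0 // -(ltn_add2l (mdeg u)) -mdegM wE (leq_trans lt) //.
by rewrite leq_add2r.
Qed.

Lemma ord_ge0 P : P \in ord_ge 0. Proof. exact/ord_geP. Qed.

Lemma ord_geW a b P : (a <= b)%N -> P \in ord_ge b -> P \in ord_ge a.
Proof.
by move=> le /ord_geP h; apply/ord_geP => w lt; rewrite h // (leq_trans lt).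
Qed.

Lemma ord_geX a k P : P \in ord_ge a -> P ^+ k \in ord_ge (k * a).
Proof.
move=> h; elim: k => [|k IH]; first exact: ord_ge0.
by rewrite exprS mulSn ord_geM.
Qed.

Fact ord_ge_submod a : submod_closed (ord_ge a).
Proof.
split=> [|c P Q /ord_geP hP /ord_geP hQ]; apply/ord_geP => w lt.
  by rewrite mcoeff0.
by rewrite mcoeffD mcoeffZ hP // hQ // mulr0 addr0.
Qed.
HB.instance Definition _ a :=
  GRing.isSubmodClosed.Build rat A (ord_ge a) (ord_ge_submod a).

(** The index is [a.+1] because [ord_ge 0] is the whole ring, hence not proper. *)
Fact ord_ge_proper a : (1 : A) \notin ord_ge a.+1 /\
  (forall P, {in ord_ge a.+1, forall Q, P * Q \in ord_ge a.+1}).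
Proof.
split=> [|P Q]; last by rewrite -[a.+1]add0n; exact/ord_geM/ord_ge0.
by apply/negP => /ord_geP /(_ 1%M); rewrite mdeg1 mcoeff1 eqxx => /(_ isT) /eqP.
Qed.
HB.instance Definition _ a := isProperIdeal.Build A (ord_ge a.+1) (ord_ge_proper a).

(** By [derivation_exp_geom] the Euler operator sends the product into [ord_ge M.+1], so its
    coefficients in degrees 1 to [M] vanish, and the constant coefficient is 1. The eigenvalue 2 is
    the degree of [x_j y_i], the intended value of [z e]. *)
Lemma exp_geom_inverse (M K n : nat) (E : finType) (z : E -> A) :
  let u k := k%:R^-1 *: \sum_e z e ^+ k in
  (forall e, euler (z e) = 2 *: z e) -> (forall e, z e \in ord_ge 1) ->
  (M <= K)%N -> (M <= n)%N ->
  (\prod_(1 <= k < K.+1) exp_trunc n (u k)) * (\prod_e (1 - z e)) - 1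
    \in ord_ge M.+1.
Proof.
move=> u z_euler z_ord leMK leMn.
have ordX k P i : (0 < k)%N -> P \in ord_ge 1 -> (i <= k)%N -> P ^+ k \in ord_ge i.
  by move=> k0 P1 ik; have := ord_geX k P1; rewrite muln1; exact: ord_geW.
have u_ord k : (0 < k)%N -> u k \in ord_ge 1.
  by move=> k0; apply: rpredZ; apply: rpred_sum => e _; exact: ordX.
set T := _ * _; have : euler T \in ord_ge M.+1.
  have h := @derivation_exp_geom A euler (ord_ge M.+1) eulerM.
  have h1 := h (fun P Q => @idealMr _ _ P Q) E z 2 K n z_euler.
  by apply: h1 => [e|k /u_ord uk]; exact: ordX.
move/ord_geP => h; apply/ord_geP => w /h.
rewrite mcoeff_euler mcoeffB mcoeff1 => /eqP; rewrite mulf_eq0 pnatr_eq0 mdeg_eq0.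
case: eqP => [->|_ /eqP ->]; rewrite ?subrr // => _.
apply/eqP; rewrite subr_eq0; apply/eqP.
pose ev : {rmorphism A -> rat} := @mcoeff _ rat (1%M : {cmonom I}).
have ev0 P : P \in ord_ge 1 -> ev P = 0 by move=> /ord_geP; apply; rewrite mdeg1.
rewrite -[LHS]/(ev T) /T rmorphM !rmorph_prod [X in _ * X]big1 => [|e _].
  rewrite mulr1 big_add1 /= big1 // => k _.
  by apply: (rmorph_exp_trunc (f := ev)) => [c Q|]; [exact: mcoeffZ | exact/ev0/u_ord].
by rewrite rmorphB rmorph1 ev0 ?subr0.
Qed.

End LowestDegree.

(** * Derivatives of complete homogeneous functions *)

Section Transport.
Context (A U : algType rat) (E : A -> U) (C : U -> A) (d : A -> A).
Hypotheses (EL : linear E) (EM : {morph E : x y / x * y}) (dL : linear d).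
Hypotheses (EK : cancel E C) (CK : cancel C E).
Hypothesis dM : forall x y, d (x * y) = d x * y + x * d y.

Let CL : linear C.
Proof. by move=> c f g; apply: (can_inj EK); rewrite CK EL !CK. Qed.

Let CM f g : C (f * g) = C f * C g.
Proof. by apply: (can_inj EK); rewrite CK EM !CK. Qed.

(** [dLambda] is a polynomial derivative conjugated by the bijection [psum_eval]; linearity and the
    Leibniz rule pass through such a conjugation. *)
Lemma transport_linear : linear (fun f => E (d (C f))).
Proof. by move=> c f g; rewrite CL dL EL. Qed.

Lemma transportM f g : E (d (C (f * g))) = E (d (C f)) * g + f * E (d (C g)).
Proof.
have ED x y : E (x + y) = E x + E y by have := EL 1 x y; rewrite !scale1r.
by rewrite CM dM ED !EM !CK.
Qed.
End Transport.

Section Derivations.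
Local Notation A := {malg rat[{cmonom var}]}.
Implicit Types (b : bool) (k : nat) (f g : Lambda) (P Q : A) (v : var).

Lemma psum_eval_linear : linear psum_eval.
Proof. by move=> c P Q; rewrite psum_evalD psum_evalZ. Qed.

Lemma psum_eval_mon (w : {cmonom var}) : psum_eval (mon w) = psum_mon w.
Proof. by rewrite monE psum_evalU scale1r. Qed.

(** The derivative of a monomial. If [v] does not occur in [w], the truncated quotient [divcm] is
    [w] itself and the coefficient is zero. *)
Let W v (w : {cmonom var}) : A := (w v)%:R *: mon (divcm w (ucm v)).

Let ppoly_derivE v P : ppoly_deriv v P = mlin (W v) P.
Proof.
rewrite mlin.unlock; apply: eq_bigr => w _; rewrite /W scalerA mulrC.
by apply/malgP => x; rewrite mcoeffZ mcoeff_mon mcoeffU -[LHS]mulr_natr.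
Qed.

Let divcm_mull (w w' : {cmonom var}) v : (0 < w v)%N ->
  divcm (w * w')%M (ucm v) = (divcm w (ucm v) * w')%M.
Proof.
move=> w0; apply/eqP/cmP => x; rewrite !(cmM, divcmE) cmU.
by case: eqP => [<-|_]; rewrite ?subn0 // addnBAC.
Qed.

Let WM v w w' : W v (w * w')%M = W v w * mon w' + mon w * W v w'.
Proof.
rewrite /W cmM natrD scalerDl; congr (_ + _).
  have [->|w0] := posnP (w v); first by rewrite !scale0r mul0r.
  by rewrite -scalerAl monM (divcm_mull _ w0).
have [->|w0] := posnP (w' v); first by rewrite !scale0r mulr0.
by rewrite -scalerAr monM (mulmC w) (divcm_mull _ w0) mulmC.
Qed.

Let ppoly_derivM v P Q :
  mlin (W v) (P * Q) = mlin (W v) P * Q + P * mlin (W v) Q.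
Proof.
have L := linearP (mlin (W v)).
apply: (malg_lin_eq (f := fun P => mlin (W v) (P * Q))
  (g := fun P => mlin (W v) P * Q + P * mlin (W v) Q)) => [c x y||w].
- by rewrite mulrDl -scalerAl; exact: L.
- exact: linear_leibnizl.
apply: (malg_lin_eq (f := fun Q => mlin (W v) (mon w * Q))
  (g := fun Q => mlin (W v) (mon w) * Q + mon w * mlin (W v) Q)) => [c x y||w'].
- by rewrite mulrDr -scalerAr; exact: L.
- exact: linear_leibnizr.
rewrite (mlinU (W v) w) (mlinU (W v) w') -WM.
by rewrite monM; exact: mlinU.
Qed.

Let dLambdaE b k : dLambda b k =
  (fun f => psum_eval (mlin (W (b, k.-1)) (psum_coord f))).
Proof. by apply/funext => f; rewrite -ppoly_derivE. Qed.

Lemma dLambda_linear b k : linear (dLambda b k).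
Proof.
rewrite dLambdaE; apply: (transport_linear psum_eval_linear _ psum_evalK psum_coordK).
exact: linearP.
Qed.

Lemma dLambdaM b k f g : dLambda b k (f * g) = dLambda b k f * g + f * dLambda b k g.
Proof.
rewrite dLambdaE.
apply: (transportM psum_eval_linear psum_evalM psum_evalK psum_coordK).
exact: ppoly_derivM.
Qed.

Let psumE b k : (0 < k)%N -> psum b k = psum_eval (mon (ucm (b, k.-1))).
Proof.
by case: k => // k _; rewrite psum_eval_mon /psum_mon mdomU big_seq_fset1 cmUU.
Qed.

Lemma dLambda_psum b b' k j : (0 < k)%N -> (0 < j)%N ->
  dLambda b k (psum b' j) = ((b == b') && (k == j))%:R.
Proof.
move=> k0 j0; rewrite psumE // dLambdaE psum_evalK mlinU /W cmU xpair_eqE.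
(* Variables are numbered from 0 and power sums from 1; the predecessor loses nothing on positive
   indices. *)
have -> : (j.-1 == k.-1) = (k == j) by lia.
rewrite [b' == b]eq_sym; case: andP => [[/eqP <- /eqP <-]|_]; last first.
  by rewrite scale0r -[0](subrr 0) psum_evalB subrr.
rewrite scale1r (_ : divcm _ _ = 1%M) ?psum_eval_mon ?/psum_mon ?mdom1.
  by rewrite big_seq_fset0.
by apply/eqP/cmP => x; rewrite divcmE cm1 subnn.
Qed.
End Derivations.

(** * Newton's identity for complete homogeneous functions *)

Section Newton.
Implicit Types (b : bool) (k n : nat) (m : {cmonom var}) (v : var).

Local Notation pw v k := (expcmn (ucm v) k).

Let pwE v k u : pw v k u = (if v == u then k else 0)%N.
Proof. by rewrite expcmnE ucmE; case: eqP; rewrite ?muln1 ?muln0. Qed.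

Let pwK v k m : (k <= m v)%N -> (pw v k * divcm m (pw v k))%M = m.
Proof.
move=> le; apply/eqP/cmP => u; rewrite cmM divcmE pwE.
by case: (v =P u) => [<-|_]; rewrite ?subnKC // subn0.
Qed.

(** The monomials of [p_k] that divide [m] are the [k]-th powers of such variables [v]; since
    [k > 0], distinct variables give distinct powers. *)
Let coef_psumM b k (g : fps var) m : (0 < k)%N ->
  coef (psum_series b k * g) m =
  \sum_(v <- finsupp m | (v.1 == b) && (k <= m v)%N) coef g (divcm m (pw v k)).
Proof.
move=> k0; rewrite Defs.coefM -[RHS]big_filter.
have mulI (u x y : {cmonom var}) : (u * x)%M = (u * y)%M -> x = y.
  move=> e; apply/eqP/cmP => v; have := congr1 (fun z : {cmonom var} => z v) e.
  by rewrite !cmM => /addnI.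
set s := [seq v <- finsupp m | _].
have sP v : v \in s -> v.1 = b /\ (k <= m v)%N.
  by rewrite mem_filter => /andP[/andP[/eqP]].
have inj : injective (fun v => (pw v k, divcm m (pw v k))).
  move=> u v [/eqP/cmP /(_ u) + _]; rewrite !pwE eqxx.
  by case: (v =P u) => // _ e; move: k0; rewrite e.
rewrite (fsbigE (map (fun v => (pw v k, divcm m (pw v k))) s)).
- rewrite big_map [LHS]big_mkcond /= !big_seq; apply: eq_bigr => v /sP [vb le].
  rewrite mem_set ?[_ v]/= /factorizations /= ?pwK //.
  rewrite (_ : `[< _ >] = true) ?mul1r //; apply/asboolP; exists v.2.
  by rewrite -vb -surjective_pairing.
- by rewrite map_inj_uniq // filter_uniq // fset_uniq.
- by move=> x /= /mapP [v /sP [_ le] ->]; exact: pwK.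
- move=> [x y] /= xy; case: asboolP => [[i xE] |_]; last by rewrite mul0r.
  subst x; have {}xy : (pw (b, i) k * y)%M = m by [].
  move=> /negP[]; rewrite -xy; apply/mapP; exists (b, i); last first.
    congr pair; apply: (mulI (pw (b, i) k)).
    by rewrite pwK // cmM pwE eqxx leq_addr.
  have le : (k <= m (b, i))%N by rewrite -xy cmM pwE eqxx leq_addr.
  by rewrite mem_filter /= eqxx le -cmE_neq0 -lt0n (leq_trans k0).
Qed.

(** At a monomial [m] of degree [n] in alphabet [b], the right-hand side counts the pairs [(v, k)]
    with [1 <= k <= m v], and their number is the sum of the exponents, that is, [n]. *)
Lemma hsym_newton b n :
  n%:R *: hsym b n%:Z = \sum_(1 <= k < n.+1) psum b k * hsym b (n - k)%N%:Z.
Proof.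
apply: seriesP.
have -> : series (\sum_(1 <= k < n.+1) psum b k * hsym b (n - k)%N%:Z) =
    \sum_(1 <= k < n.+1) psum_series b k * hsym_series b (n - k).
  exact: (raddf_sum (\val : Lambda -> fps var)).
apply: fpsP => m.
transitivity (\sum_(1 <= k < n.+1)
  \sum_(v <- finsupp m | (v.1 == b) && (k <= m v)%N)
     coef (hsym_series b n) m); last first.
  rewrite (big_morph (fun f => coef f m) (fun f g => Defs.coefD f g m) (Defs.coef0 m)).
  rewrite !big_nat; apply: eq_bigr => k /andP[k0 kn].
  rewrite [RHS]coef_psumM //; apply: eq_bigr => v /andP[/eqP vb le].
  rewrite /=; congr (nat_of_bool _)%:R.
  rewrite -{1 2}(pwK le) mdegM.
  have -> : mdeg (pw v k) = k.
    rewrite (@mdegEw _ _ [fset v]%fset); first by rewrite big_seq_fset1 pwE eqxx.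
    apply/fsubsetP => u; rewrite -cmE_neq0 pwE inE [u == v]eq_sym.
    by case: (v == u).
  rewrite -{1}(subnKC (ltnSE kn)) eqn_add2l; congr (_ && _).
  rewrite mdomD; apply/allP/allP => h u; last first.
    rewrite inE => /orP[|/h //]; rewrite -cmE_neq0 pwE.
    by case: (v =P u) => [<-|//]; rewrite vb.
  by move=> ud; apply: h; rewrite inE ud orbT.
rewrite [LHS]Defs.coefZ /=; case: andP => [[/eqP dm /allP mb]|_]; last first.
  by rewrite mulr0 big1 // => k _; rewrite big1.
rewrite mulr1 (exchange_big_dep (fun v => v.1 == b)) /= => [|k v _ /andP[] //].
rewrite -[in LHS]dm mdegE natr_sum big_seq [RHS]big_seq_cond; apply: eq_big => [v|v vm].
  by case vm : (v \in _) => //=; exact/esym/mb.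
rewrite [RHS](_ : _ = \sum_(1 <= k < (m v).+1) 1).
  by rewrite sumr_const_nat subn1.
rewrite [RHS](@big_nat_widen _ _ _ _ _ n.+1) ?ltnS.
  by apply: eq_bigl => k; rewrite (eqP (mb v vm)) eqxx.
by rewrite -dm mdegE (big_fsetD1 v) //= leq_addr.
Qed.

(** Allows a negative degree and a summation bound that is too large, as in the induction of
    [dLambda_hsym]; the extra terms vanish with [hsym] in negative degree. *)
Lemma hsym_newton_int b (z : int) n : z <= n%:Z ->
  z%:~R *: hsym b z = \sum_(1 <= k < n.+1) psum b k * hsym b (z - k%:Z).
Proof.
case: z => [z|z] le.
  rewrite [LHS]hsym_newton [RHS](big_cat_nat _ (n := z.+1)) //.
  rewrite [X in _ = _ + X]big_nat [X in _ = _ + X]big1 ?addr0.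
    by rewrite !big_nat; apply: eq_bigr => k /andP[_ kz]; rewrite subzn.
  move=> k /andP[zk _].
  suff -> : hsym b (z%:Z - k%:Z) = 0 by rewrite mulr0.
  by have -> : z%:Z - k%:Z = Negz (k - z.+1) by lia.
rewrite scaler0 big1 // => k _.
have -> : Negz z - k%:Z = Negz (z + k) by lia.
exact: mulr0.
Qed.

(** Strong induction on the degree. When the alphabets agree, differentiating
    [n h_n = sum_j p_j h_(n-j)] gives [h_(n-k)] plus [(1/k) sum_j p_j h_(n-k-j)], which is
    [((n-k)/k) h_(n-k)] by Newton's identity again; the total is [(n/k) h_(n-k)]. *)
Lemma dLambda_hsym b b' k (z : int) : (0 < k)%N ->
  dLambda b k (hsym b' z) =
  if b == b' then k%:R^-1 *: hsym b' (z - k%:Z) else 0.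
Proof.
move=> k0; pose D : {linear Lambda -> Lambda} := HB.pack (dLambda b k)
  (GRing.isLinear.Build rat Lambda Lambda *:%R (dLambda b k) (@dLambda_linear b k)).
have D1 : D 1 = 0.
  have := @dLambdaM b k 1 1; rewrite !mulr1 mul1r => /(congr1 (+%R (- D 1))).
  by rewrite addNr addKr.
case: z => [n|n]; last first.
  rewrite [LHS](linear0 D); case: eqP => // _.
  have -> : Negz n - k%:Z = Negz (n + k) by lia.
  exact/esym/scaler0.
elim/ltn_ind: n => -[_|n IH].
  rewrite [hsym b' _]hsym0 [LHS]D1; case: eqP => // _.
  have -> : 0%:Z - k%:Z = Negz k.-1 by lia.
  exact/esym/scaler0.
have n0 : n.+1%:R != 0 :> rat by rewrite pnatr_eq0.
apply: (scalerI n0); rewrite -[LHS](linearZ_LR D) hsym_newton [LHS](linear_sum D).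
transitivity (\sum_(1 <= j < n.+2)
  (((b == b') && (k == j))%:R * hsym b' (n.+1%:Z - j%:Z) +
   psum b' j * if b == b' then k%:R^-1 *: hsym b' (n.+1%:Z - k%:Z - j%:Z) else 0)).
  rewrite !big_nat; apply: eq_bigr => j /andP[j0 jn].
  rewrite [D _]dLambdaM dLambda_psum // IH; last by lia.
  have -> : (n.+1 - j)%N%:Z = n.+1%:Z - j%:Z by lia.
  by congr (_ + _ * _); case: eqP => // _; congr (_ *: hsym _ _); lia.
rewrite big_split /=; case: eqP => [<-|_]; last first.
  by rewrite scaler0 big1 ?big1 ?addr0 // => j _; rewrite ?mul0r ?mulr0.
under [X in _ + X]eq_bigr do rewrite -scalerAr.
rewrite -scaler_sumr -(@hsym_newton_int b (n.+1%:Z - k%:Z)); last by lia.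
have -> : \sum_(1 <= j < n.+2) (true && (k == j))%:R * hsym b (n.+1%:Z - j%:Z) =
    hsym b (n.+1%:Z - k%:Z).
  have [kn|nk] := leqP k n.+1.
    rewrite (bigD1_seq k) ?mem_index_iota ?iota_uniq ?k0 //= eqxx mul1r big1 ?addr0 //.
    by move=> j jk; rewrite eq_sym (negbTE jk) mul0r.
  (* For [k > n.+1] no summand has [j = k], and the right-hand side has negative degree. *)
  rewrite big_nat big1 => [|j /andP[_ jn]].
    by have -> : n.+1%:Z - k%:Z = Negz (k - n.+2) by lia.
  by rewrite (_ : (k == j) = false) ?mul0r //; lia.
rewrite -{1}[hsym b _]scale1r !scalerA -scalerDl; congr (_ *: _).
have k0' : k%:R != 0 :> rat by rewrite pnatr_eq0 -lt0n.
by rewrite rmorphB /=; field.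
Qed.

End Newton.

(** * Delta on products of complete homogeneous functions *)

(** Uniqueness of the list makes the test [u == v] select a single factor. *)
Lemma derivation_prod (R : comNzRingType) (I : eqType) (D : R -> R) (f : I -> R)
    (r : seq I) :
  (forall x y, D (x * y) = D x * y + x * D y) -> uniq r ->
  D (\prod_(v <- r) f v) =
  \sum_(v <- r) \prod_(u <- r) (if u == v then D (f u) else f u).
Proof.
move=> DM; have D1 : D 1 = 0.
  by have := DM 1 1; rewrite !mulr1 mul1r => /(congr1 (+%R (- D 1))); rewrite addNr addKr.
elim: r => [|a r IH] /=; first by rewrite !big_nil.
move=> /andP[ar ur]; rewrite !big_cons DM IH // eqxx; congr (_ + _).
  congr (_ * _); rewrite !big_seq; apply: eq_bigr => u ur'.
  by case: eqP => // ua; rewrite -ua ur' in ar.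
rewrite mulr_sumr !big_seq; apply: eq_bigr => v vr; rewrite big_cons.
by case: eqP => // av; rewrite av vr in ar.
Qed.

Section LinearDet.
Context (A U : algType rat) (S : {linear A -> U}) (d : nat).

Let S_sign (e : bool) P : S ((-1) ^+ e * P) = (-1) ^+ e * S P.
Proof. by case: e; rewrite ?expr1 ?expr0 ?mulN1r ?mul1r // linearN. Qed.

(** [S] is only linear, so compatibility with products is asked for exactly those products that
    occur in the Leibniz expansion. *)
Lemma linear_det (P : 'M[A]_d) (p : 'M[U]_d) :
  (forall s : {perm 'I_d}, S (\prod_i P i (s i)) = \prod_i p i (s i)) ->
  S (\det P) = \det p.
Proof.
by move=> h; rewrite linear_sum; apply: eq_bigr => s _; rewrite S_sign h.
Qed.

Lemma linear_det2 (P Q : 'M[A]_d) (p q : 'M[U]_d) :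
  (forall s t : {perm 'I_d}, S ((\prod_i P i (s i)) * \prod_i Q i (t i)) =
    (\prod_i p i (s i)) * \prod_i q i (t i)) ->
  S (\det P * \det Q) = \det p * \det q.
Proof.
have signC (V : algType rat) (e : bool) (x : V) : x * (-1) ^+ e = (-1) ^+ e * x.
  by case: e; rewrite ?expr1 ?expr0 ?mulN1r ?mulrN1 ?mul1r ?mulr1.
have mulC (V : algType rat) (e e' : bool) (x y : V) :
    (-1) ^+ e * x * ((-1) ^+ e' * y) = (-1) ^+ e * ((-1) ^+ e' * (x * y)).
  by rewrite -!mulrA (mulrA x) signC -!mulrA.
move=> h; rewrite /determinant !big_distrlr linear_sum; apply: eq_bigr => s _ /=.
rewrite linear_sum; apply: eq_bigr => t _ /=.
by rewrite !mulC !S_sign h.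
Qed.
End LinearDet.

Lemma prod_perm (R : comNzRingType) d (s : {perm 'I_d}) (f g h : 'I_d -> R) :
  (forall i, h i = f i * g (s i)) ->
  \prod_i h i = (\prod_i g i) * \prod_i f i.
Proof.
move=> hE; rewrite [X in X * _](reindex_inj (@perm_inj _ s)) mulrC -big_split.
by apply: eq_bigr => i _; rewrite hE.
Qed.

Section DeltaAction.
Context (A : comAlgType rat) (U : lmodType rat) (S : {linear A -> U}).
Context (dd : bool -> nat -> U -> U) (u : nat -> A).
Hypothesis ddZ : forall b k (c : rat) f, dd b k (c *: f) = c *: dd b k f.
Hypothesis ddS : forall k P, (0 < k)%N ->
  dd false k (dd true k (S P)) = k%:R^-1 *: S (P * u k).

(** Every application of the second-order operator contributes [k^-1] and a factor [u k]; the powers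
    of [k] cancel and the exponential series in [u k] is left. *)
Lemma Delta_factor_action n k P : (0 < k)%N ->
  Delta_factor dd n k (S P) = S (P * exp_trunc n (u k)).
Proof.
move=> k0; have kN0 : k%:R != 0 :> rat by rewrite pnatr_eq0 -lt0n.
have it i : iter i (dd false k \o dd true k) (S P) =
    (k%:R^-1 ^+ i) *: S (P * u k ^+ i).
  elim: i => [|i IH]; first by rewrite !expr0 scale1r mulr1.
  by rewrite iterS IH /comp !ddZ (ddS _ k0) scalerA -exprSr -mulrA -exprSr.
rewrite /exp_trunc mulr_sumr linear_sum; apply: eq_bigr => i _.
have e : k%:R ^+ i / i`!%:R * k%:R^-1 ^+ i = i`!%:R^-1 :> rat.
  by rewrite exprVn mulrAC divff ?mul1r // expf_neq0.
by rewrite it scalerA e -scalerAr linearZ_LR.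
Qed.

Lemma Delta_trunc_action K n P :
  Delta_trunc dd K n (S P) = S (P * \prod_(1 <= k < K.+1) exp_trunc n (u k)).
Proof.
(* The induction needs an arbitrary list of positive indices in place of an interval. *)
suff H r : all (leq 1) r -> forall P,
    (\big[@comp U U U/id]_(k <- r) Delta_factor dd n k) (S P) =
    S (P * \prod_(k <- r) exp_trunc n (u k)).
  by apply: H; apply/allP => k; rewrite mem_index_iota => /andP[].
elim: r => [_|k r IH /andP[k0 /IH {}IH]] {}P; first by rewrite !big_nil mulr1.
rewrite !big_cons /comp IH Delta_factor_action //.
by rewrite -mulrA [_ * exp_trunc _ _]mulrC.
Qed.
End DeltaAction.

(** * Polynomials in shift variables and their images in [Lambda] *)

Section Shift.
Context (d : nat) (top : bool * 'I_d -> nat).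
Local Notation I := (bool * 'I_d)%type.
Local Notation A := {malg rat[{cmonom I}]}.
Implicit Types (P Q : A) (w : {cmonom I}) (v : I) (b : bool) (k n : nat).

(* The variable [xvar (b, i)] acts on a product of complete homogeneous functions by
   lowering the degree of the [i]-th factor in alphabet [b]. *)
Definition shift_base w : Lambda :=
  \prod_v hsym v.1 ((top v)%:Z - (w v)%:Z).
Definition shift : A -> Lambda := mlin shift_base.

Fact shift_linear : linear shift. Proof. exact: linearP. Qed.
HB.instance Definition _ := GRing.isLinear.Build rat A Lambda *:%R shift shift_linear.

Lemma shift_mon w : shift (mon w) = shift_base w. Proof. exact: mlinU. Qed.

Definition xvar v : A := mon (ucm v).

Let pw v k : {cmonom I} := iter k (mmul (ucm v)) 1%M.

Let pwE v k u : pw v k u = if v == u then k else 0%N.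
Proof.
elim: k => [|k IH]; first by rewrite cm1 if_same.
by rewrite cmM cmU IH; case: (v == u).
Qed.

Let XE v k : xvar v ^+ k = mon (pw v k).
Proof.
elim: k => [|k IH]; first by rewrite expr0 monE.
by rewrite exprS IH /xvar monM.
Qed.

(** [shift] is not a ring morphism in general, so the exponents of all variables must be gathered in
    one monomial first. *)
Lemma shift_prodX (e : I -> nat) :
  shift (\prod_v xvar v ^+ e v) = \prod_v hsym v.1 ((top v)%:Z - (e v)%:Z).
Proof.
pose w := \big[mmul/1%M]_v pw v (e v).
have -> : \prod_v xvar v ^+ e v = mon w.
  rewrite /w; elim: (index_enum _) => [|v r IH]; first by rewrite !big_nil monE.
  by rewrite !big_cons IH XE monM.
rewrite shift_mon; apply: eq_bigr => v _; congr (hsym _ (_ - _%:Z)).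
rewrite /w (big_morph (fun m : {cmonom I} => m v) (cmM v) (cm1 v)).
rewrite (bigD1 v) //= pwE eqxx big1 ?addn0 // => u uv.
by rewrite pwE (negbTE uv).
Qed.

(** On a monomial, the Leibniz rule lowers one factor of alphabet [b] at a time by [k], with
    coefficient [1/k]; this is multiplication by [xvar (b, i) ^+ k]. *)
Lemma dLambda_shift b k P : (0 < k)%N ->
  dLambda b k (shift P) = k%:R^-1 *: shift (P * \sum_i xvar (b, i) ^+ k).
Proof.
move=> k0.
pose D : {linear Lambda -> Lambda} := HB.pack (dLambda b k)
  (GRing.isLinear.Build rat Lambda Lambda *:%R (dLambda b k) (@dLambda_linear b k)).
apply: (malg_lin_eq (f := fun P => D (shift P))
  (g := fun P => k%:R^-1 *: shift (P * \sum_i xvar (b, i) ^+ k))) => [c x y|c x y|w].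
- by rewrite shift_linear; exact: linearP.
- by rewrite mulrDl -scalerAl shift_linear scalerDr !scalerA mulrC.
rewrite shift_mon [LHS]derivation_prod ?index_enum_uniq //; last exact: dLambdaM.
rewrite mulr_sumr linear_sum scaler_sumr -(pair_bigA _ (fun b' i =>
  \prod_u if u == (b', i) then D (hsym u.1 ((top u)%:Z - (w u)%:Z))
          else hsym u.1 ((top u)%:Z - (w u)%:Z))) /=.
(* Factors of the other alphabet have zero derivative. *)
rewrite (bigD1 b) //= [X in _ + X]big1 ?addr0 => [|b' b'b]; last first.
  rewrite big1 // => i _; rewrite (bigD1 (b', i)) //= eqxx dLambda_hsym //.
  by rewrite eq_sym (negbTE b'b) mul0r.
apply: eq_bigr => i _; rewrite XE monM shift_mon /shift_base.
rewrite (bigD1 (b, i)) //= [in RHS](bigD1 (b, i)) //= eqxx dLambda_hsym // eqxx.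
rewrite -(scalerAl k%:R^-1 (hsym b ((top (b,i))%:Z - (w (b,i))%:Z - k%:Z))).
congr (_ *: _); apply: (congr2 *%R).
  by congr hsym; rewrite cmM pwE eqxx; lia.
apply: eq_bigr => u ub; rewrite (negbTE ub) cmM pwE eq_sym (negbTE ub).
by rewrite addn0.
Qed.

Definition zvar (e : 'I_d * 'I_d) : A := xvar (false, e.1) * xvar (true, e.2).
(** The [k]-th term of the logarithm of the Cauchy kernel [prod_e 1 / (1 - z_e)]. *)
Definition zpsum k : A := k%:R^-1 *: \sum_e zvar e ^+ k.

Let dLambdaZ b k (c : rat) f : dLambda b k (c *: f) = c *: dLambda b k f.
Proof.
have d0 : dLambda b k 0 = 0.
  have := @dLambda_linear b k (-1) 0 0.
  by rewrite scaler0 addr0 scaleN1r addNr.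
by have := @dLambda_linear b k c f 0; rewrite addr0 d0 addr0.
Qed.

Let shiftZ (c : rat) P : shift (c *: P) = c *: shift P.
Proof. exact: linearZ_LR. Qed.

Let sum_zX k : (\sum_i xvar (true, i) ^+ k) * (\sum_i xvar (false, i) ^+ k) =
  \sum_e zvar e ^+ k.
Proof.
rewrite mulrC big_distrlr pair_bigA; apply: eq_bigr => e _ /=.
by rewrite exprMn.
Qed.

Let dd_shift k P : (0 < k)%N ->
  dLambda false k (dLambda true k (shift P)) = k%:R^-1 *: shift (P * zpsum k).
Proof.
move=> k0; rewrite (dLambda_shift _ _ k0) dLambdaZ (dLambda_shift _ _ k0).
by rewrite -mulrA sum_zX /zpsum -scalerAr shiftZ.
Qed.

Lemma Delta_trunc_shift K n P :
  Delta_trunc dLambda K n (shift P) =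
  shift (P * \prod_(1 <= k < K.+1) exp_trunc n (zpsum k)).
Proof. exact: Delta_trunc_action. Qed.

Let mdeg_fin w : mdeg w = (\sum_v w v)%N.
Proof.
rewrite (@mdegEw _ _ [fset v in enum {: I}]%fset); last first.
  by apply/fsubsetP => v _; rewrite !inE mem_enum.
rewrite -[RHS]big_enum; apply: perm_big.
apply: uniq_perm; rewrite ?fset_uniq ?enum_uniq //.
by move=> v; rewrite !inE.
Qed.

(** A monomial whose degree exceeds the sum of all [top v] has some exponent above [top v], which
    gives a factor [hsym] of negative degree. *)
Lemma shift_ord_ge P : P \in ord_ge (\sum_v top v).+1 -> shift P = 0.
Proof.
move=> /ord_geP h; rewrite /shift mlin.unlock big1 // => w _.
have [lt|le] := ltnP (mdeg w) (\sum_v top v).+1; first by rewrite h // scale0r.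
have [v lt] : exists v, (top v < w v)%N.
  apply/existsP; apply: contraLR le => /existsPn no.
  rewrite -ltnNge ltnS mdeg_fin; apply: leq_sum => v _.
  by rewrite leqNgt no.
rewrite /shift_base (bigD1 v) //=.
have -> : (top v)%:Z - (w v)%:Z = Negz (w v - (top v).+1) by lia.
by rewrite mul0r scaler0.
Qed.

Let z_mon e : zvar e = mon (ucm (false, e.1) * ucm (true, e.2))%M.
Proof. exact: monM. Qed.

Let z_ord e : zvar e \in ord_ge 1.
Proof.
apply/ord_geP => w; rewrite ltnS leqn0 mdeg_eq0 => /eqP ->.
by rewrite z_mon mcoeff_mon cmM_eq1 cm1_eq1.
Qed.

Let z_euler e : euler (zvar e) = 2 *: zvar e.
Proof. by rewrite z_mon eulerU mdegM !mdegU. Qed.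

Definition weyl_num : A :=
  \det (\matrix_(j < d, k < d) xvar (false, j) ^+ k.+1) *
  \det (\matrix_(i < d, k < d) xvar (true, i) ^+ k.+1).

(** The entries are [x_j y_i / (1 - x_j y_i)] cut after [N] terms; the exponent starts at 1, as does
    the summation index in [bTW]. *)
Definition cauchy_det N : A :=
  \det (\matrix_(i < d, j < d) \sum_(k < N) (xvar (false, j) * xvar (true, i)) ^+ k.+1).

(** Both truncations are errors of degree above the sum of all [top v], and [shift] sends such
    polynomials to 0. *)
Lemma Delta_trunc_weyl K n N :
  (\sum_v top v <= K)%N -> (\sum_v top v <= n)%N -> (\sum_v top v < N)%N ->
  Delta_trunc dLambda K n (shift weyl_num) = shift (cauchy_det N).
Proof.
move=> leK len ltN; rewrite Delta_trunc_shift; apply/eqP.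
rewrite -subr_eq0 -linearB; apply/eqP; apply: shift_ord_ge.
apply: Cauchy_kernel_mod => [i j|].
  (* The power [(x_j y_i) ^+ N] has degree at least [N], which exceeds the sum of all [top v]. *)
  by have := ord_geX N (z_ord (j, i)); rewrite muln1; apply: ord_geW.
exact: exp_geom_inverse z_euler z_ord leK len.
Qed.

Let shift_prod2 (a b : 'I_d -> nat) :
  shift ((\prod_i xvar (false, i) ^+ a i) * \prod_i xvar (true, i) ^+ b i) =
  (\prod_i hsym false ((top (false, i))%:Z - (a i)%:Z)) *
  \prod_i hsym true ((top (true, i))%:Z - (b i)%:Z).
Proof.
pose e v := if v.1 then b v.2 else a v.2.
have pairE (R : comNzRingType) (G : I -> R) :
    \prod_v G v = (\prod_i G (false, i)) * \prod_i G (true, i).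
  transitivity (\prod_(b : bool) \prod_i G (b, i)).
    by rewrite pair_bigA; apply: eq_bigr => -[].
  by rewrite big_bool mulrC.
by have := shift_prodX e; rewrite !pairE.
Qed.

Lemma shift_weyl : shift weyl_num =
  \det (\matrix_(j < d, k < d) hsym false ((top (false, j))%:Z - k.+1%:Z)) *
  \det (\matrix_(i < d, k < d) hsym true ((top (true, i))%:Z - k.+1%:Z)).
Proof.
apply: linear_det2 => s t.
apply: etrans (etrans _ (shift_prod2 (fun j => (s j).+1) (fun i => (t i).+1))) _.
  apply: (congr1 shift); apply: (congr2 *%R); apply: eq_bigr => i _; exact: mxE.
apply: (congr2 *%R); apply: eq_bigr => i _; exact/esym/mxE.
Qed.

Lemma shift_kernel N : shift (cauchy_det N) =
  \det (\matrix_(i < d, j < d) \sum_(k < N)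
    hsym true ((top (true, i))%:Z - k.+1%:Z) *
    hsym false ((top (false, j))%:Z - k.+1%:Z)).
Proof.
apply: linear_det => s.
under eq_bigr do rewrite mxE; under [RHS]eq_bigr do rewrite mxE.
rewrite !bigA_distr_bigA linear_sum; apply: eq_bigr => f _ /=.
(* The term [f i] chosen in row [i] involves the column variable [s i], so the columns read the
   choice through the inverse of [s]. *)
pose g j := (f ((s^-1)%g j)).+1.
have fE i : (f i).+1 = g (s i) by rewrite /g permK.
apply: etrans (etrans _ (shift_prod2 g (fun i => (f i).+1))) _.
  apply: (congr1 shift); apply: (@prod_perm _ _ s) => i.
  by rewrite -fE mulrC exprMn.
by apply/esym; apply: (@prod_perm _ _ s) => i; rewrite -fE.
Qed.

End Shift.

(** * Jacobi-Trudi determinants *)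

Lemma hsym_neg b (z : int) : z < 0 -> hsym b z = 0.
Proof. by case: z. Qed.

Lemma fsbig_posn (R : nmodType) (f : nat -> R) N :
  (forall k, (N <= k)%N -> f k.+1 = 0) ->
  \sum_(k \in [set k : nat | (1 <= k)%N]) f k = \sum_(k < N) f k.+1.
Proof.
move=> f0; rewrite (fsbigE (iota 1 N)) ?iota_uniq //=.
- rewrite (iotaDl 1 0) big_map.
  have -> : iota 0 N = index_iota 0 N by rewrite /index_iota subn0.
  by rewrite big_mkord; apply: eq_big => // k; apply/mem_set.
- by move=> k /=; rewrite mem_iota => /andP[].
- move=> [|k] // _; rewrite mem_iota /= add1n ltnS -leqNgt; exact: f0.
Qed.

Section Reductions.
Implicit Types (b : bool) (d : nat) (l m : seq nat).

(** For a partition with at most [d] parts, the Jacobi-Trudi determinant of its Schur function, with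
    the rows and the columns both in reverse order. *)
Definition schur b d l : Lambda := \det (\matrix_(j < d, k < d)
  hsym b ((j.+1 + part l (d - j.+1 + 1))%N%:Z - k.+1%:Z)).

Let entryE b d l (i : 'I_d) k :
  hsym b (i.+1%:Z - k%:Z + (part l (d - i.+1 + 1))%:Z) =
  hsym b ((i.+1 + part l (d - i.+1 + 1))%N%:Z - k%:Z).
Proof. by congr hsym; lia. Qed.

Let part0 i : part [::] i = 0%N. Proof. by rewrite /part nth_nil. Qed.

Let det_unitrig b d :
  \det (\matrix_(i < d, k < d) hsym b (i.+1%:Z - k.+1%:Z)) = 1.
Proof.
rewrite det_trig; last first.
  by apply/is_trig_mxP => i k ik; rewrite mxE hsym_neg //; lia.
by rewrite big1 // => i _; rewrite mxE subrr hsym0.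
Qed.

(** With [m] empty the left factor vanishes beyond column [d], so the matrix is a product of square
    matrices, of which the left one is unitriangular. *)
Lemma bTW_l0 d l : bTW d l [::] = schur false d l.
Proof.
rewrite /bTW /schur -[RHS]mul1r -(det_unitrig true d) -[X in _ * X]det_tr -det_mulmx.
congr (\det _); apply/matrixP => i j; rewrite !mxE (fsbig_posn (N := d)) => [|k dk].
  by apply: eq_bigr => k _; rewrite !mxE part0 addr0 entryE.
by rewrite part0 addr0 hsym_neg ?mul0r //; have := ltn_ord i; lia.
Qed.

Lemma bTW_0m d m : bTW d [::] m = schur true d m.
Proof.
rewrite /bTW /schur -[RHS]mulr1 -(det_unitrig false d) -[X in _ * X]det_tr -det_mulmx.
congr (\det _); apply/matrixP => i j; rewrite !mxE (fsbig_posn (N := d)) => [|k dk].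
  by apply: eq_bigr => k _; rewrite !mxE part0 addr0 entryE.
by rewrite part0 addr0 [X in _ * X]hsym_neg ?mulr0 //; have := ltn_ord j; lia.
Qed.

(** The first row belongs to the part of index [d.+1], which is zero, so this row is
    [(1, 0, ..., 0)]. *)
Lemma schur_stable b d l : part l d.+1 = 0%N -> schur b d.+1 l = schur b d l.
Proof.
move=> l0; rewrite /schur (expand_det_row _ 0).
have row0 (k : 'I_d.+1) : (\matrix_(j < d.+1, k < d.+1)
    hsym b ((j.+1 + part l (d.+1 - j.+1 + 1))%N%:Z - k.+1%:Z)) 0 k = (k == 0)%:R.
  rewrite mxE subn1 addn1 l0; have [->|k0] := eqVneq k 0; first by rewrite subrr hsym0.
  by rewrite hsym_neg //; move: k0; rewrite -val_eqE /=; lia.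
rewrite (bigD1 0) //= big1 => [|k k0]; last by rewrite row0 (negbTE k0) mul0r.
rewrite row0 mul1r addr0 /cofactor expr0 mul1r.
congr (\det _); apply/matrixP => j k; rewrite !mxE !lift0 subSS.
by congr hsym; lia.
Qed.

Lemma partition_part0 l d d' : is_partition l -> part l d.+1 = 0%N ->
  (d <= d')%N -> part l d'.+1 = 0%N.
Proof.
rewrite /part /= => lP l0 le.
have [lt|] := ltnP d' (size l); last by move=> ?; rewrite nth_default.
have geq_tr : transitive geq by move=> x y u yx xu; exact: leq_trans xu yx.
have := sorted_leq_nth geq_tr leqnn 0%N lP d d'.
rewrite !inE l0 lt (leq_ltn_trans le lt) => /(_ isT isT le).
by rewrite /geq /= leqn0 => /eqP.
Qed.

Lemma schur_indep b d d' l : is_partition l ->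
  part l d.+1 = 0%N -> part l d'.+1 = 0%N -> schur b d l = schur b d' l.
Proof.
move=> lP; wlog le : d d' / (d <= d')%N.
  by move=> H h h'; case: (leqP d d') => [/H|/ltnW /H] ->.
move=> l0 _; rewrite -(subnKC le); elim: (d' - d)%N => [|e IH].
  by rewrite addn0.
by rewrite addnS schur_stable // (partition_part0 lP l0) // leq_addr.
Qed.

(** Two stable values agree, as both are reached beyond the larger of the two thresholds. *)
Lemma Delta_eq (U : lmodType rat) (dd : bool -> nat -> U -> U) f g N :
  (forall K n, (N <= K)%N -> (N <= n)%N -> Delta_trunc dd K n f = g) ->
  Delta dd f = g.
Proof.
move=> h; apply: xget_unique; first by exists N.
move=> y [M hM]; rewrite -(h (maxn N M) (maxn N M)) ?leq_maxl //.
by rewrite -(hM (maxn N M) (maxn N M)) ?leq_maxr.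
Qed.

(** Since [Delta] is defined by choice of a stable value, [F] is moved across the finite
    truncations, where linearity and [F_dLambda] suffice. *)
Lemma F_Delta_trunc K n f :
  F (Delta_trunc dLambda K n f) = Delta_trunc dV K n (F f).
Proof.
rewrite /Delta_trunc; elim: (index_iota _ _) f => [|k r IH] f; first by rewrite !big_nil.
rewrite !big_cons /comp /Delta_factor -IH; move: (bigop _ _ _ f) => {}f.
rewrite linear_sum; apply: eq_bigr => i _; rewrite linearZ_LR; congr (_ *: _).
by elim: (nat_of_ord i) => //= j <-; rewrite !F_dLambda.
Qed.

Lemma Delta_trunc_bTW d l m : exists N, forall K n, (N <= K)%N -> (N <= n)%N ->
  Delta_trunc dLambda K n (schur false d l * schur true d m) = bTW d l m.
Proof.
(* These are the indices [i + mu_(d-i+1)] and [j + lambda_(d-j+1)], from which the summation index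
   is subtracted in [bTW]. Their sum is the threshold. *)
pose top (v : bool * 'I_d) :=
  (v.2.+1 + part (if v.1 then m else l) (d - v.2.+1 + 1))%N.
exists (\sum_v top v)%N => K n leK len.
have := Delta_trunc_weyl leK len (ltnSn _).
rewrite shift_weyl shift_kernel => ->.
congr (\det _); apply/matrixP => i j; rewrite !mxE.
rewrite (fsbig_posn (N := (\sum_v top v).+1)) => [|k lek].
  by apply: eq_bigr => k _; rewrite !entryE.
(* Past the threshold the factor in alphabet Y has negative degree, so the infinite sum is the
   truncated one. *)
have : (top (true, i) <= \sum_v top v)%N by rewrite (bigD1 (true, i)) //= leq_addr.
move=> /leq_ltn_trans /(_ lek) lt; rewrite entryE hsym_neg ?mul0r //.
by move: lt; rewrite {1}/top /= -ltz_nat; lia.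
Qed.
End Reductions.

Theorem theorem3 (l m : seq nat) (d1 d2 d : nat) :
  is_partition l -> is_partition m ->
  (1 <= d1)%N -> part l d1.+1 = 0%N ->
  (1 <= d2)%N -> part m d2.+1 = 0%N ->
  (1 <= d)%N -> part l d.+1 = 0%N -> part m d.+1 = 0%N ->
  Delta dV (TW d1 l [::] * TW d2 [::] m) = TW d l m /\
  Delta dLambda (bTW d1 l [::] * bTW d2 [::] m) = bTW d l m.
Proof.
move=> lP mP _ l1 _ m2 _ l0 m0.
(* Both factors are brought to the common size [d], where the Weyl numerator lives. *)
have E : bTW d1 l [::] * bTW d2 [::] m = schur false d l * schur true d m.
  rewrite bTW_l0 bTW_0m (schur_indep _ lP l1 l0).
  by rewrite (schur_indep _ mP m2 m0).
have [N hN] := Delta_trunc_bTW d l m; split; apply: (@Delta_eq _ _ _ _ N) => K n leK len.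
  by rewrite /TW -rmorphM E -F_Delta_trunc hN.
by rewrite E hN.
Qed.
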